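(* Let $f_1,f_2:\mathbb{R}^d\to\mathbb{R}^d$ be contracting similarities with the same contraction ratio $r_1=r_2=r\in(0,1)$, and suppose there is a non-empty bounded open set $U\subset\mathbb{R}^d$ such that $f_i(U)\subset U$ for $i=1,2$, $f_1(U)\cap f_2(U)=\emptyset$, and $U$ is the interior of its closure. Let $p\in(0,1)$ and let $F$ be the random set generated by $\{f_1,f_2\}$, the binary tree ($M=2$), and the probability vector $(p,1-p)$, as described in the context. Define $$\xi=\xi(p):=\frac{\log (2p)}{\log p-\log(1-p)}\quad\text{for } p\neq 1/2,\qquad \xi(1/2):=1/2.$$ Then, almost surely, $$\dim_H F=\dim_B F=\frac{\xi\log\xi+(1-\xi)\log(1-\xi)}{\log r}.$$
   Context: Logarithms are natural. $\dim_H$ and $\dim_B$ denote Hausdorff and box-counting dimension. A similarity $f$ with contraction ratio $r$ satisfies $|f(x)-f(y)|=r|x-y|$ for all $x,y$. Construction of $F$: consider the infinite binary tree (the rooted tree in which every vertex has exactly 2 children) with edge set $E$. Let $\omega(e)$, $e\in E$, be independent random variables with values in $\{1,2\}$, $\mathbb{P}(\omega(e)=1)=p$ and $\mathbb{P}(\omega(e)=2)=1-p$. Let $\mathcal{P}$ be the set of infinite paths starting at the root (moving away from the root), and let $P(k)$ denote the $k$-th edge of $P\in\mathcal{P}$. Then $$F=F(\omega):=\Big\{\lim_{n\to\infty} f_{\omega(P(1))}\circ\dots\circ f_{\omega(P(n))}(0): P\in\mathcal{P}\Big\}.$$ ''Almost surely'' refers to the law of $\omega$. *)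

(* Defs.v *)
From HB Require Import structures.
From mathcomp Require Import all_boot all_order all_algebra.
From mathcomp Require Import all_classical all_reals all_analysis.

Set Implicit Arguments.
Unset Strict Implicit.
Unset Printing Implicit Defensive.

Import Order.TTheory GRing.Theory Num.Theory.
Import numFieldNormedType.Exports.

Local Open Scope classical_set_scope.
Local Open Scope ring_scope.

Section EuclideanSpace.
Context {R : realType} {d : nat}.
Implicit Types (x y : 'rV[R]_d) (A F : set 'rV[R]_d).

(* [`|x|] is the sup norm on matrices, so the Euclidean norm is introduced
   separately. The two induce the same topology and the same bounded sets. *)
Definition enorm x : R := Num.sqrt (\sum_(i < d) x 0 i ^+ 2).

Definition similarity (r : R) (f : 'rV[R]_d -> 'rV[R]_d) : Prop :=
  forall x y, enorm (f x - f y) = r * enorm (x - y).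

(* [maxe 0] only matters for the empty set, as [ereal_sup set0 = -oo]. *)
Definition diam A : \bar R :=
  maxe 0%E (ereal_sup [set (enorm (z.1 - z.2))%:E | z in A `*` A]).

(* [|A|^s], with the convention that the empty set contributes [0] even for
   [s = 0]. *)
Definition diam_pow (s : R) A : \bar R :=
  if A == set0 then 0%E else (diam A `^ s)%E.

Definition hausdorff_premeasure (s delta : R) F : \bar R :=
  ereal_inf [set (\sum_(0 <= i <oo) diam_pow s (C i))%E
            | C in [set C : nat -> set 'rV[R]_d |
                     F `<=` \bigcup_i C i
                     /\ forall i, (diam (C i) <= delta%:E)%E]].

Definition hausdorff_measure (s : R) F : \bar R :=
  ereal_sup [set hausdorff_premeasure s delta F
            | delta in [set delta : R | 0 < delta]].

Definition hausdorff_dim F : \bar R :=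
  ereal_inf [set s%:E | s in [set s : R |
                               0 <= s /\ hausdorff_measure s F = 0%E]].

(* Smallest number of sets of diameter at most [delta] covering [F]
   ([+oo] if there is no finite cover). *)
Definition covering_number (delta : R) F : \bar R :=
  ereal_inf [set n%:R%:E | n in [set n : nat |
    exists C : 'I_n -> set 'rV[R]_d,
      F `<=` \bigcup_i C i /\ forall i, (diam (C i) <= delta%:E)%E]].

(* The box-counting dimension is a limit that need not exist, hence a
   relation: it exists and equals [D]. *)
Definition has_box_dim F (D : \bar R) : Prop :=
  (lne (covering_number delta F) * ((- ln delta)^-1)%:E)%E
    @[delta --> 0^'+] --> D.

End EuclideanSpace.

(* A vertex of the infinite binary tree is the word of left/right choices
   leading to it from the root [[::]]; the edge [(v, b)] joins [v] to its
   child [rcons v b]. *)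
Definition vertex : Type := seq bool.
Definition edge : eqType := (seq bool * bool)%type.
Definition source (e : edge) : vertex := e.1.
Definition target (e : edge) : vertex := rcons e.1 e.2.

(* [P k] is the [k.+1]-st edge of the path. *)
Definition is_path (P : nat -> edge) : Prop :=
  source (P 0%N) = [::] /\ forall k, source (P k.+1) = target (P k).

(* The composition in the limit is
   [f (w (P 0)) \o ... \o f (w (P n.-1))]. *)
Definition generated_set {R : realType} {d : nat} {I : Type}
    (f : I -> 'rV[R]_d -> 'rV[R]_d) (w : edge -> I) : set 'rV[R]_d :=
  [set x | exists2 P, is_path P &
    (\big[comp/idfun]_(k < n) f (w (P k))) 0 @[n --> \oo] --> x].

Definition mutually_independent {d d' : measure_display}
    {T : measurableType d} {T' : measurableType d'} {R : realType}
    (P : probability T R) {I : eqType} (X : I -> T -> T') : Prop :=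
  forall (J : seq I) (A : I -> set T'),
    uniq J -> (forall i, measurable (A i)) ->
    P [set t | forall i, i \in J -> X i t \in A i]
    = (\prod_(i <- J) P (X i @^-1` A i))%E.

Definition xi {R : realType} (p : R) : R :=
  if p == 2^-1 then 2^-1 else ln (2 * p) / (ln p - ln (1 - p)).

(* Main.v *)
Require Import Defs.
From mathcomp Require Import all_boot all_order all_algebra.
From mathcomp Require Import all_classical all_reals all_analysis.
From mathcomp Require Import ring lra.

Set Implicit Arguments.
Unset Strict Implicit.
Unset Printing Implicit Defensive.

Import Order.TTheory GRing.Theory Num.Theory.
Import numFieldNormedType.Exports.

Local Open Scope classical_set_scope.
Local Open Scope ring_scope.

(** The limit set splits into cells indexed by the words of labels that appear
    in the tree, and a word of length [n] gives a cell of size [r ^+ n]. Both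
    dimensions are therefore [ln L / - ln r] where [L] is the exponential growth
    rate of the number of distinct words. Write [w true = p], [w false = 1 - p]
    and [drift c = ln (2 * w c)]; a given word [u] is carried by
    [expR (walk u)] vertices on average, with [walk u] the sum of its drifts.

    Upper bound for the number of words. A word appears with probability at most
    the minimum of 1 and [expR (walk u)], hence at most [expR (s * walk u)] for
    every [s] in [[0, 1]]. Summing over words gives a mean number of at most
    [(\sum_c expR (s * drift c)) ^+ n] ([expect_nb_words_le]). At the critical
    point of this sum in [s], given by Rolle's theorem ([exists_tilt]), its value
    [L] is the exponential of the entropy of [xi p] ([entropy_tilt]). Markov's
    inequality and the Borel-Cantelli lemma turn this into an almost sure bound
    ([ae_few_words]), and the covers by cells bound both dimensions from above.

    Lower bound for the mean. A word whose walk stays above a constant appears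
    with probability at least of order [1 / n] ([appear_prob_ge]), and the words with a
    bounded walk have growth rate arbitrarily close to [L]
    ([count_stays_within], through an eigenfunction of the walk killed outside an
    interval). This covers the case [p = 1 / 2], where the tree carries each
    word once on average and each given infinite word is almost surely absent.

    From the mean to a tree. Take one vertex for each word that appears at depth
    [m]; the subtrees below these vertices are independent. A dyadic level
    carrying a fair share of the mean ([exists_typical_level]) and Chebyshev's inequality
    show that, with positive probability, there is a tree of words with at least
    [B] branches every [m] levels, where [B] is close to [L ^+ m]
    ([exists_regular]). As the [2 ^ n] subtrees at depth [n] are independent,
    almost surely some subtree has this property ([ae_regular_subtree]).

    From the tree to the dimension. By the disjointness of the images of [U] and
    a packing argument, a set of diameter [r ^+ n] comes close to a bounded number
    of cells of level [n]. A cover of the limit set thus gives a cut of the tree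
    of words, and a cut has weight at least 1 ([regular_cut],
    [regular_cover_bound]). This bounds from below the Hausdorff sums
    ([hausdorff_measure_neq0]) and the covering numbers ([covering_number_ge]). *)

(** * Labelled binary trees and their words *)

(** The edge [(v, b)] leaves the vertex [v]; a labelling is one realisation of
    the random labels, with [true] and [false] the two maps of the system. *)
Definition labelling : Type := edge -> bool.

Definition subtree (a : bool) (x : labelling) : labelling :=
  fun e => x (a :: e.1, e.2).

Fixpoint subtree_at (v : seq bool) (x : labelling) : labelling :=
  if v is a :: v' then subtree_at v' (subtree a x) else x.

Fixpoint word (x : labelling) (v : seq bool) : seq bool :=
  if v is a :: v' then x ([::], a) :: word (subtree a x) v' else [::].

Fixpoint words (n : nat) : seq (seq bool) :=
  if n is n'.+1
  then [seq true :: u | u <- words n'] ++ [seq false :: u | u <- words n']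
  else [:: [::]].

(** Some vertex at depth [size u] is reached along the labels [u] and has a
    subtree satisfying [G]. Recursion on the word, rather than a quantifier over
    vertices, makes the two subtrees of the root visible, and these are
    independent. *)
Fixpoint appears (G : labelling -> bool) (u : seq bool) (x : labelling) : bool :=
  if u is c :: u' then
    (x ([::], true) == c) && appears G u' (subtree true x) ||
    (x ([::], false) == c) && appears G u' (subtree false x)
  else G x.

(** Distinct words are counted, not vertices: vertices with equal words give
    the same piece of the limit set. *)
Definition nb_words (G : labelling -> bool) (n : nat) (x : labelling) : nat :=
  count (appears G ^~ x) (words n).

Definition graft (c1 c0 : bool) (x1 x0 : labelling) : labelling :=
  fun e => match e.1 with
           | [::] => if e.2 then c1 else c0
           | a :: v => if a then x1 (v, e.2) else x0 (v, e.2)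
           end.

Definition depends_below {A : Type} (n : nat) (g : labelling -> A) : Prop :=
  forall x y, (forall e : edge, (size e.1 < n)%N -> x e = y e) -> g x = g y.

Section Words.

Lemma mem_words n u : (u \in words n) = (size u == n).
Proof.
elim: n u => [|n IH] [|c u] //=.
  by rewrite mem_cat; apply/negbTE/norP; split; apply/mapP => -[].
rewrite mem_cat eqSS -IH; have inj b : injective (cons b : seq bool -> _) by move=> ? ? [].
case: c; rewrite (mem_map (inj _)).
  by rewrite [X in _ || X](_ : _ = false) ?orbF //; apply/mapP => -[].
by rewrite [X in X || _](_ : _ = false) //; apply/mapP => -[].
Qed.

Lemma uniq_words n : uniq (words n).
Proof.
elim: n => //= n IH; rewrite cat_uniq !map_inj_uniq ?IH ?andbT //=; try by move=> ? ? [].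
by apply/hasPn => u /mapP[u' _ ->]; apply/mapP => -[].
Qed.

Lemma size_words n : size (words n) = (2 ^ n)%N.
Proof. by elim: n => //= n IH; rewrite size_cat !size_map IH expnS mul2n addnn. Qed.

Lemma big_words (R : pzRingType) n (F : seq bool -> R) :
  \sum_(u <- words n.+1) F u =
  \sum_(u <- words n) F (true :: u) + \sum_(u <- words n) F (false :: u).
Proof. by rewrite /= big_cat !big_map. Qed.

Lemma subtree_graft1 c1 c0 x1 x0 : subtree true (graft c1 c0 x1 x0) = x1.
Proof. by apply/funext => -[]. Qed.

Lemma subtree_graft0 c1 c0 x1 x0 : subtree false (graft c1 c0 x1 x0) = x0.
Proof. by apply/funext => -[]. Qed.

Lemma subtree_atE v x e : subtree_at v x e = x (v ++ e.1, e.2).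
Proof. by elim: v x e => [x []//|a v IH x e] /=; rewrite IH. Qed.

Lemma word_cat x u v : word x (u ++ v) = word x u ++ word (subtree_at u x) v.
Proof. by elim: u x => //= a u IH x; rewrite IH. Qed.

Lemma size_word x v : size (word x v) = size v.
Proof. by elim: v x => //= a v IH x; rewrite IH. Qed.

Lemma appearsP (G : labelling -> bool) u x :
  reflect (exists v, [/\ size v = size u, word x v = u & G (subtree_at v x)])
          (appears G u x).
Proof.
elim: u x => [|c u IH] x /=.
  apply: (iffP idP) => [Gx|]; first by exists [::].
  by case=> -[|a v] [].
apply: (iffP orP) => [[] /andP[/eqP xc /IH[v [sv wv Gv]]]|[[|[] v] [//= [sv] [xc wv] Gv]]].
- by exists (true :: v); rewrite /= sv xc wv.
- by exists (false :: v); rewrite /= sv xc wv.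
- by left; apply/andP; split; [exact/eqP|apply/IH; exists v].
- by right; apply/andP; split; [exact/eqP|apply/IH; exists v].
Qed.

Lemma word_depends v n : (size v <= n)%N -> depends_below n (word ^~ v).
Proof.
elim: v n => //= a v IH [//|n] sv x y xy; congr cons; first exact: xy.
by apply: (IH n) => // -[u b] su; exact: xy.
Qed.

Lemma appears_depends (G : labelling -> bool) n k u : (size u = n)%N -> depends_below k G ->
  depends_below (n + k) (appears G u).
Proof.
elim: u n => [|c u IH] [//|n] su Gk x y xy /=; first exact: Gk.
have sub a e : (size e.1 < n + k)%N -> subtree a x e = subtree a y e.
  by move=> se; apply: xy; rewrite addSn.
case: su => su; have IH' a := IH n su Gk _ _ (sub a).
by rewrite !IH' !xy.
Qed.

Lemma nb_words_depends (G : labelling -> bool) n k : depends_below k G ->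
  depends_below (n + k) (nb_words G n).
Proof.
move=> Gk x y xy; apply: eq_in_count => u; rewrite mem_words => /eqP su.
exact: (appears_depends su Gk).
Qed.

Lemma subtree_at_depends (A : Type) v n k (g : labelling -> A) : size v = n ->
  depends_below k g -> depends_below (n + k) (g \o subtree_at v).
Proof.
move=> sv gk x y xy; apply: gk => e se; rewrite !subtree_atE xy //=.
by rewrite size_cat sv ltn_add2l.
Qed.

End Words.

(** * Expectation over random labellings *)

Section Expectation.
Context {R : realType} (w : bool -> R).

Definition base_labelling : labelling := fun=> true.

(** Expectation over the labels of the edges of depth less than [n], the deeper
    ones being read in [base_labelling]. Splitting off the root makes the
    independence of the two subtrees hold by definition and spares a sample
    space; [prob_labels] relates it to the actual probability. *)
Fixpoint expect (n : nat) (g : labelling -> R) : R :=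
  if n is n'.+1 then
    \sum_(c1 : bool) \sum_(c0 : bool) w c1 * w c0 *
      expect n' (fun x1 => expect n' (fun x0 => g (graft c1 c0 x1 x0)))
  else g base_labelling.

Definition prob (n : nat) (A : labelling -> bool) : R :=
  expect n (fun x => (A x)%:R).

Lemma eq_expect n g h : g =1 h -> expect n g = expect n h.
Proof. by move=> /funext ->. Qed.

Lemma expectD n g h : expect n (fun x => g x + h x) = expect n g + expect n h.
Proof.
elim: n g h => //= n IH g h; rewrite !big_bool /=.
by do 4 rewrite (eq_expect n (fun x1 => IH _ _)) IH; ring.
Qed.

Lemma expectZ n a g : expect n (fun x => a * g x) = a * expect n g.
Proof.
elim: n a g => //= n IH a g; rewrite !big_bool /=.
by do 4 rewrite (eq_expect n (fun x1 => IH _ _)) IH; ring.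
Qed.

Lemma expectZr n a g : expect n (fun x => g x * a) = expect n g * a.
Proof. by rewrite mulrC -expectZ; apply: eq_expect => x; rewrite mulrC. Qed.

Lemma expectB n g h : expect n (fun x => g x - h x) = expect n g - expect n h.
Proof.
rewrite -[- expect n h]mulN1r -expectZ -expectD.
by apply: eq_expect => x; rewrite mulN1r.
Qed.

Lemma expect0 n : expect n (fun=> 0) = 0.
Proof.
by rewrite -[RHS](mul0r (expect n (fun=> 0))) -expectZ; apply: eq_expect => x; rewrite mul0r.
Qed.

Lemma expect_sum n (I : Type) (s : seq I) (g : I -> labelling -> R) :
  expect n (fun x => \sum_(i <- s) g i x) = \sum_(i <- s) expect n (g i).
Proof.
elim: s => [|i s IH].
  by rewrite big_nil -[RHS](expect0 n); apply: eq_expect => x; rewrite big_nil.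
rewrite big_cons -IH -expectD; apply: eq_expect => x.
by rewrite big_cons.
Qed.

(** As [expect] is defined by recursion at the root, the independence of the two
    halves of the tree is distributivity. *)
Lemma expect_split n (g1 g0 : bool -> labelling -> R) :
  expect n.+1 (fun x => g1 (x ([::], true)) (subtree true x) *
                        g0 (x ([::], false)) (subtree false x)) =
  (\sum_(c : bool) w c * expect n (g1 c)) * (\sum_(c : bool) w c * expect n (g0 c)).
Proof.
have E c1 c0 : expect n (fun x1 => expect n (fun x0 =>
    g1 c1 x1 * g0 c0 x0)) = expect n (g1 c1) * expect n (g0 c0).
  by rewrite (eq_expect n (fun x1 => expectZ n _ _)) expectZr.
rewrite /= !big_bool /=.
have E' c1 c0 : expect n (fun x1 => expect n (fun x0 =>
    g1 (graft c1 c0 x1 x0 ([::], true)) (subtree true (graft c1 c0 x1 x0)) *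
    g0 (graft c1 c0 x1 x0 ([::], false)) (subtree false (graft c1 c0 x1 x0)))) =
    expect n (g1 c1) * expect n (g0 c0).
  by rewrite -E; do 2 (apply: eq_expect => ?); rewrite subtree_graft1 subtree_graft0.
by rewrite !E'; ring.
Qed.

Context (w_ge0 : forall c, 0 <= w c) (w_sum : w true + w false = 1).

Lemma expect_cst n a : expect n (fun=> a) = a.
Proof.
elim: n => //= n IH; rewrite !big_bool /= !IH.
transitivity ((w true + w false) * (w true + w false) * a); first by ring.
by rewrite w_sum !mul1r.
Qed.

Lemma le_expect n g h : (forall x, g x <= h x) -> expect n g <= expect n h.
Proof.
elim: n g h => //= n IH g h gh.
by do 2 (apply: ler_sum => ? _); apply: ler_wpM2l; rewrite ?mulr_ge0//; do 2 apply/IH => ?.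
Qed.

Lemma prob_ge0 n A : 0 <= prob n A.
Proof. by rewrite -(expect0 n); apply: le_expect => x; rewrite ler0n. Qed.

Lemma prob_le1 n A : prob n A <= 1.
Proof. by rewrite -[leRHS](expect_cst n); apply: le_expect => x; rewrite lern1 leq_b1. Qed.

Lemma depends_below_graft1 (A : Type) n c1 c0 x0 (g : labelling -> A) :
  depends_below n.+1 g -> depends_below n (fun x1 => g (graft c1 c0 x1 x0)).
Proof. by move=> gn x y xy; apply: gn => -[[|[] v] b] //= sv; exact: xy. Qed.

Lemma depends_below_graft0 (A : Type) n c1 c0 x1 (g : labelling -> A) :
  depends_below n.+1 g -> depends_below n (fun x0 => g (graft c1 c0 x1 x0)).
Proof. by move=> gn x y xy; apply: gn => -[[|[] v] b] //= sv; exact: xy. Qed.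

Lemma depends_below_expect n k c1 c0 (g : labelling -> R) :
  depends_below n.+1 g ->
  depends_below n (fun x1 => expect k (fun x0 => g (graft c1 c0 x1 x0))).
Proof.
move=> gn x y xy; apply: eq_expect => x0.
exact: (depends_below_graft1 _ _ _ gn).
Qed.

Lemma expect_stable n k g : depends_below n g -> expect (n + k) g = expect n g.
Proof.
elim: n g => [|n IH] g gn.
  rewrite (@eq_expect _ _ (fun=> g base_labelling)) ?expect_cst //.
  by move=> x; apply: gn.
rewrite /= !big_bool /=.
have E c1 c0 : expect (n + k) (fun x1 => expect (n + k) (fun x0 =>
    g (graft c1 c0 x1 x0))) = expect n (fun x1 => expect n (fun x0 =>
    g (graft c1 c0 x1 x0))).
  rewrite IH; last exact: depends_below_expect.
  by apply: eq_expect => x1; rewrite IH //; exact: depends_below_graft0.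
by rewrite !E.
Qed.

Lemma expect_subtree n k v phi g : size v = n -> depends_below n phi ->
  expect (n + k) (fun x => phi x * g (subtree_at v x)) = expect n phi * expect k g.
Proof.
elim: n v phi => [|n IH] [|a v] phi //= => [_ phin|[sv] phin].
  rewrite -expectZ; apply: eq_expect => x; congr (_ * _); exact: phin.
have E c1 c0 : expect (n + k) (fun x1 => expect (n + k) (fun x0 =>
    phi (graft c1 c0 x1 x0) * g (subtree_at v (subtree a (graft c1 c0 x1 x0))))) =
    expect n (fun x1 => expect n (fun x0 => phi (graft c1 c0 x1 x0))) * expect k g.
  case: a.
  - transitivity (expect (n + k) (fun x1 =>
      expect (n + k) (fun x0 => phi (graft c1 c0 x1 x0)) * g (subtree_at v x1))).
      apply: eq_expect => x1; rewrite -expectZr; apply: eq_expect => x0.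
      by rewrite subtree_graft1.
    rewrite IH //; last exact: depends_below_expect.
    congr (_ * _); apply: eq_expect => x1.
    by rewrite expect_stable //; exact: depends_below_graft0.
  - transitivity (expect (n + k) (fun x1 =>
      expect n (fun x0 => phi (graft c1 c0 x1 x0)) * expect k g)).
      apply: eq_expect => x1; rewrite -(IH v) //; last exact: depends_below_graft0.
      by apply: eq_expect => x0; rewrite subtree_graft0.
    by rewrite expectZr expect_stable //; exact: depends_below_expect.
by rewrite !big_bool /= !E; ring.
Qed.

(** With [g] and [g'] centred, this kills the off-diagonal terms of the variance
    of a sum over vertices of depth [n] selected by the top levels. *)
Lemma expect_subtree2 n k v v' phi g g' :
  size v = n -> size v' = n -> v != v' -> depends_below n phi ->
  expect (n + k) (fun x => phi x * g (subtree_at v x) * g' (subtree_at v' x)) =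
  expect n phi * expect k g * expect k g'.
Proof.
elim: n v v' phi g g' => [|n IH] [|a v] [|a' v'] phi g g' //= [sv] [sv'] vv' phin.
have E c1 c0 : expect (n + k) (fun x1 => expect (n + k) (fun x0 =>
    phi (graft c1 c0 x1 x0) * g (subtree_at v (subtree a (graft c1 c0 x1 x0))) *
    g' (subtree_at v' (subtree a' (graft c1 c0 x1 x0))))) =
    expect n (fun x1 => expect n (fun x0 => phi (graft c1 c0 x1 x0))) *
    expect k g * expect k g'.
  have mixed u u' h h' : size u = n -> size u' = n ->
      expect (n + k) (fun x1 => expect (n + k) (fun x0 =>
      phi (graft c1 c0 x1 x0) * h (subtree_at u x1) * h' (subtree_at u' x0))) =
    expect n (fun x1 => expect n (fun x0 => phi (graft c1 c0 x1 x0))) *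
    expect k h * expect k h'.
    move=> su su'.
    transitivity (expect (n + k) (fun x1 =>
      (expect n (fun x0 => phi (graft c1 c0 x1 x0)) * h (subtree_at u x1)) * expect k h')).
      apply: eq_expect => x1; rewrite mulrAC -(expect_subtree k h' su'); last first.
        exact: depends_below_graft0.
      by rewrite -expectZr; apply: eq_expect => x0; rewrite mulrAC.
    rewrite expectZr expect_subtree //; exact: depends_below_expect.
  case: a a' vv' => -[] vv'.
  - transitivity (expect (n + k) (fun x1 =>
      expect (n + k) (fun x0 => phi (graft c1 c0 x1 x0)) * g (subtree_at v x1) *
      g' (subtree_at v' x1))).
      apply: eq_expect => x1; rewrite -mulrA -expectZr; apply: eq_expect => x0.
      by rewrite subtree_graft1 mulrA.
    rewrite IH //; last exact: depends_below_expect.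
    congr (_ * _ * _); apply: eq_expect => x1.
    by rewrite expect_stable //; exact: depends_below_graft0.
  - rewrite -(mixed v v') //; do 2 (apply: eq_expect => ?).
    by rewrite subtree_graft1 subtree_graft0.
  - rewrite mulrAC -(mixed v' v) //; do 2 (apply: eq_expect => ?).
    by rewrite subtree_graft1 subtree_graft0 mulrAC.
  - transitivity (expect (n + k) (fun x1 =>
      expect n (fun x0 => phi (graft c1 c0 x1 x0)) * expect k g * expect k g')).
      apply: eq_expect => x1; rewrite -(IH v v') //; last exact: depends_below_graft0.
      by apply: eq_expect => x0; rewrite subtree_graft0.
    by rewrite !expectZr expect_stable //; exact: depends_below_expect.
by rewrite !big_bool /= !E; ring.
Qed.

End Expectation.

(** * The probability that a given word appears *)

Section FirstMoment.
Context {R : realType} (w : bool -> R).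

(** A word [u] is carried by [2 ^ size u * \prod_(c <- u) w c] vertices on
    average. This number is [expR (walk u)], so that [drift c] is the step of the
    walk that decides whether a word is likely to appear. *)
Definition drift (c : bool) : R := ln (2 * w c).

Definition walk (u : seq bool) : R := \sum_(c <- u) drift c.

Definition appear_prob (u : seq bool) : R := prob w (size u) (appears xpredT u).

Fixpoint stays_within (M S : R) (u : seq bool) : bool :=
  (`|S| <= M) && (if u is c :: u' then stays_within M (S + drift c) u' else true).

Context (w_gt0 : forall c, 0 < w c) (w_sum : w true + w false = 1).
Let w_ge0 c : 0 <= w c := ltW (w_gt0 c).

Lemma w_le1 c : w c <= 1.
Proof. by case: c; move: w_sum (w_gt0 true) (w_gt0 false); lra. Qed.

Lemma appear_prob_ge0 u : 0 <= appear_prob u.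
Proof. exact: prob_ge0. Qed.

Lemma appear_prob_le1 u : appear_prob u <= 1.
Proof. exact: prob_le1. Qed.

(** A word [c :: u] fails to appear exactly when it fails through each of the
    two children of the root, independently. *)
Lemma appear_prob_cons c u :
  appear_prob (c :: u) = 1 - (1 - w c * appear_prob u) ^+ 2.
Proof.
pose g b x : R := 1 - (b == c)%:R * (appears xpredT u x)%:R.
have E : \sum_b w b * expect w (size u) (g b) = 1 - w c * appear_prob u.
  have Eb b : expect w (size u) (g b) = 1 - (b == c)%:R * appear_prob u.
    by rewrite /g expectB expect_cst // expectZ.
  transitivity (w true + w false - w c * appear_prob u); last by rewrite w_sum.
  by rewrite big_bool !Eb; case: c {g Eb} => /=; ring.
rewrite -E -[_ ^+ 2]/(_ * _) -expect_split /appear_prob /prob.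
rewrite -[X in X - _](expect_cst w_sum (size u).+1) -expectB.
apply: eq_expect => x; rewrite /= /g.
by case: eqP => _; case: eqP => _; case: (appears _ _ _); case: (appears _ _ _); rewrite /=; ring.
Qed.

Lemma expect_nb_words n :
  expect w n (fun x => (nb_words xpredT n x)%:R) = \sum_(u <- words n) appear_prob u.
Proof.
transitivity (\sum_(u <- words n) expect w n (fun x => (appears xpredT u x)%:R : R)).
  rewrite -expect_sum; apply: eq_expect => x.
  by rewrite /nb_words -sum1_count natr_sum big_mkcond; apply: eq_bigr => u _; case: ifP.
by apply: eq_big_seq => u; rewrite mem_words => /eqP su; rewrite /appear_prob su.
Qed.

Lemma expR_drift c : expR (drift c) = 2 * w c.
Proof. by rewrite lnK // posrE mulr_gt0. Qed.

Lemma appear_prob_le_walk u : appear_prob u <= expR (walk u).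
Proof.
elim: u => [|c u IH]; first by rewrite /walk big_nil expR0.
rewrite /walk big_cons expRD expR_drift appear_prob_cons.
have := sqr_ge0 (w c * appear_prob u); have := ler_wpM2l (w_ge0 c) IH.
rewrite /walk => H1 H2; nra.
Qed.

(** Markov's inequality bounds the probability by [expR (walk u)], and it is
    at most 1; a power with exponent in [[0, 1]] interpolates between the two
    bounds. *)
Lemma appear_prob_le_power s u : 0 <= s <= 1 -> appear_prob u <= expR (s * walk u).
Proof.
move=> /andP[s0 s1]; have [wu|wu] := leP 0 (walk u).
  by apply: le_trans (appear_prob_le1 u) _; rewrite -expR0 ler_expR mulr_ge0.
apply: le_trans (appear_prob_le_walk u) _; rewrite ler_expR; nra.
Qed.

(** The exponential of the walk is multiplicative along words, so the sum over
    all words of a given length factorises. *)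
Lemma sum_words_power n s :
  \sum_(u <- words n) expR (s * walk u) = (\sum_c expR (s * drift c)) ^+ n.
Proof.
elim: n => [|n IH]; first by rewrite expr0 big_seq1 /walk big_nil mulr0 expR0.
rewrite big_words exprS -IH big_bool mulrDl !big_distrr /=.
by congr (_ + _); apply: eq_bigr => u _; rewrite -expRD /walk big_cons mulrDr.
Qed.

Lemma expect_nb_words_le n s : 0 <= s <= 1 ->
  expect w n (fun x => (nb_words xpredT n x)%:R) <= (\sum_c expR (s * drift c)) ^+ n.
Proof.
move=> s01; rewrite expect_nb_words -sum_words_power.
by apply: ler_sum => u _; exact: appear_prob_le_power.
Qed.

(** If the walk never goes below [- M], then the word appears with a probability
    that is only polynomially small. Writing [t] for the probability that [u]
    appears, [1 - (1 - w c * t) ^+ 2] is [2 * w c * t * (1 - w c * t / 2)], whose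
    inverse is at most [1 / (2 * w c * t) + 1 / 2]: inverses grow by at most a
    bounded amount beyond what the walk dictates. *)
Lemma appear_prob_ge M S u : stays_within M S u ->
  1 <= appear_prob u * ((size u)%:R + 1) * expR (M + S).
Proof.
elim: u S => [|c u IH] S /= /andP[].
  rewrite ler_norml => /andP[SM _] _.
  by rewrite mul1r add0r mul1r -expR0 ler_expR; lra.
rewrite ler_norml => /andP[SM _] /IH.
rewrite (_ : M + (S + drift c) = drift c + (M + S)); last by ring.
rewrite [expR (drift c + _)]expRD expR_drift.
have : 1 <= expR (M + S) by rewrite -expR0 ler_expR; lra.
rewrite appear_prob_cons -natr1; set E := expR _; set t := appear_prob u; set k := (size u)%:R.
have k0 : 0 <= k by rewrite ler0n.
have t0 : 0 <= t := appear_prob_ge0 u.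
have t1 : t <= 1 := appear_prob_le1 u.
have := w_le1 c; have := w_gt0 c; set a := w c => a0 a1 E1 H.
have ta1 : t * a <= 1 by nra.
have ta0 : 0 <= t * a by nra.
have -> : 1 - (1 - a * t) ^+ 2 = (t * a) * (2 - t * a) by ring.
have H' : 1 <= 2 * (t * a) * ((k + 1) * E) by apply: le_trans H _; rewrite le_eqVlt; apply/orP; left; apply/eqP; ring.
set y := t * a in ta1 ta0 H' *.
have : 0 <= y * E by nra.
have : (1 - y / 2) <= (2 * y * ((k + 1) * E)) * (1 - y / 2).
  by rewrite ler_peMl //; lra.
have : y <= y * E by nra.
nra.
Qed.

Lemma count_words_cons (P : pred (seq bool)) n :
  count P (words n.+1) =
  (count (fun u => P (true :: u)) (words n) + count (fun u => P (false :: u)) (words n))%N.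
Proof. by rewrite /= count_cat !count_map. Qed.

(** Words whose walk stays in [[- M, M]] are counted with an eigenfunction of
    the walk killed outside this interval. The function
    [expR (s * S) * cos (eta * S)] is nonnegative on the interval and, because
    the steps are short, nonpositive at the points which the walk can reach in
    one step outside. The two assumptions on [s] and [eta] say that one step
    multiplies it by at least [La]. *)
Lemma count_stays_within n eta s La S : 0 < eta -> 0 <= La ->
  (forall c, eta * `|drift c| <= pi / 2) ->
  \sum_c expR (s * drift c) * sin (eta * drift c) = 0 ->
  La <= \sum_c expR (s * drift c) * cos (eta * drift c) ->
  let M := pi / 2 / eta in `|S| <= M ->
  La ^+ n * (expR (s * S) * cos (eta * S)) <=
  expR (`|s| * M) * (count (stays_within M S) (words n))%:R.
Proof.
move=> eta0 La0 small sin0 cosL M.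
have Mgt0 : 0 < M by rewrite !divr_gt0 // pi_gt0.
have etaM : eta * M = pi / 2 by rewrite /M mulrC divfK // gt_eqF.
elim: n S => [|n IH] S SM.
  rewrite expr0 mul1r /= SM /= mulr1.
  apply: le_trans (_ : expR (s * S) <= _).
    by rewrite -[leRHS]mulr1 ler_wpM2l ?expR_ge0 ?cos_le1.
  rewrite ler_expR (le_trans (ler_norm _)) // normrM ler_wpM2l //.
rewrite count_words_cons natrD mulrDr.
have step c : La ^+ n * (expR (s * (S + drift c)) * cos (eta * (S + drift c))) <=
    expR (`|s| * M) * (count (fun u => stays_within M S (c :: u)) (words n))%:R.
  rewrite /= SM /=; have [SdM|SdM] := leP `|S + drift c| M.
    exact: IH.
  apply: (@le_trans _ _ 0); last by rewrite mulr_ge0 ?expR_ge0.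
  rewrite mulr_ge0_le0 ?exprn_ge0 // mulr_ge0_le0 ?expR_ge0 //.
  have -> : cos (eta * (S + drift c)) = cos (eta * `|S + drift c|).
    by case: (ger0P (S + drift c)) => _ //; rewrite mulrN cosN.
  have lo : pi / 2 <= eta * `|S + drift c| by rewrite -etaM ler_wpM2l // ltW.
  have hi : eta * `|S + drift c| <= pi.
    apply: (@le_trans _ _ (eta * (`|S| + `|drift c|))).
      by rewrite ler_wpM2l ?ler_normD // ltW.
    rewrite mulrDr (splitr pi) lerD // -etaM ler_wpM2l // ltW //.
  set th := eta * _ in lo hi *.
  have -> : cos th = - sin (th - pi / 2) by rewrite sinB cos_pihalf sin_pihalf; ring.
  by rewrite oppr_le0 sin_ge0_pi // ; apply/andP; split; move: (pi_gt0 R); lra.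
apply: le_trans (lerD (step true) (step false)).
rewrite -mulrDr exprSr -mulrA ler_wpM2l ?exprn_ge0 //.
have cosS : 0 <= cos (eta * S).
  apply: cos_ge0_pihalf; rewrite -etaM -mulrN.
  by move: SM; rewrite ler_norml => /andP[S1 S2]; apply/andP; split; apply: ler_wpM2l => //; exact: ltW.
have -> : expR (s * (S + drift true)) * cos (eta * (S + drift true)) +
    expR (s * (S + drift false)) * cos (eta * (S + drift false)) =
    expR (s * S) * (cos (eta * S) * (\sum_c expR (s * drift c) * cos (eta * drift c)) -
                    sin (eta * S) * (\sum_c expR (s * drift c) * sin (eta * drift c))).
  by rewrite !big_bool !mulrDr !expRD !cosD; ring.
rewrite sin0 mulr0 subr0 mulrCA ler_wpM2l ?expR_ge0 // mulrC ler_wpM2l //.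
Qed.

End FirstMoment.

(** * The critical tilt *)

Section Tilt.
Context {R : realType} (w : bool -> R).
Context (w_gt0 : forall c, 0 < w c) (w_sum : w true + w false = 1).

(** The sum of the exponentials is 2 both at [s = 0] and at [s = 1], since the
    two weights sum to 1. Rolle's theorem gives a critical point in between; this
    is the exponent at which the first moment bound is best. *)
Lemma exists_tilt : exists2 s : R, 0 <= s <= 1 &
  \sum_c expR (s * drift w c) * drift w c = 0.
Proof.
pose f (s : R) : R := expR (s * drift w true) + expR (s * drift w false).
have df (s : R) : is_derive s 1 f (\sum_c expR (s * drift w c) * drift w c).
  rewrite big_bool.
  have H c : is_derive s 1 (fun s : R => expR (s * drift w c)) (expR (s * drift w c) * drift w c).
    apply: is_derive_eq; by rewrite /= !scaler0 add0r mulrC /= !scaler1 -[RHS]mulrC.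
  exact: is_deriveD.
have f01 : f 0 = f 1.
  rewrite /f !mul0r !mul1r !(expR_drift w_gt0) expR0 -mulrDr w_sum; ring.
have [x|| s s01 ds] := Rolle (ltr01 : (0 : R) < 1) _ _ f01.
- by move=> _; case: (df x).
- by apply: derivable_within_continuous => x _; case: (df x).
exists s; first by move: s01; rewrite in_itv /= => /andP[/ltW-> /ltW->].
have := df s; have := ds; move=> [_ <-] [_ <-]; by [].
Qed.

(** At the critical exponent, the tilted weights [expR (s * drift c) / L] are
    [xi p] for [false] and [1 - xi p] for [true]. Their mean drift vanishes, so
    the linear term disappears from the entropy and [ln L] remains. *)
Lemma entropy_tilt s : \sum_c expR (s * drift w c) * drift w c = 0 ->
  let L := \sum_c expR (s * drift w c) in
  let x := xi (w true) in
  1 < L /\ ln L = - (x * ln x + (1 - x) * ln (1 - x)).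
Proof.
move=> tilt L x; move: tilt; rewrite big_bool /=.
set lt := drift w true; set lf := drift w false => tilt.
have LE : L = expR (s * lt) + expR (s * lf) by rewrite /L big_bool.
have a0 : 0 < expR (s * lt) := expR_gt0 _.
have b0 : 0 < expR (s * lf) := expR_gt0 _.
have L0 : 0 < L by rewrite LE addr_gt0.
have xE : x = expR (s * lf) / L.
  rewrite /x /xi; case: eqP => [wt|wt].
    have wf : w false = 2^-1 by move: w_sum; rewrite wt; lra.
    by rewrite LE /lt /lf /drift wt wf mulfV // ln1 mulr0 expR0 div1r.
  have -> : ln (2 * w true) = lt by [].
  have wf : 1 - w true = w false by rewrite -w_sum; ring.
  have ltlf : lt - lf = ln (w true) - ln (w false).
    by rewrite /lt /lf /drift !lnM ?posrE //; ring.
  rewrite wf -ltlf.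
  have nz : lt - lf != 0.
    rewrite ltlf subr_eq0; apply/eqP => /ln_inj; rewrite !posrE => /(_ (w_gt0 _) (w_gt0 _)) E.
    apply: wt; move: w_sum; rewrite -E => EE; clear -EE; lra.
  apply/eqP; rewrite eqr_div //; last by rewrite gt_eqF.
  by apply/eqP; rewrite LE; move: tilt; set a := expR _; set b := expR _; nra.
have yE : 1 - x = expR (s * lt) / L by rewrite xE LE; field; rewrite gt_eqF // addr_gt0.
have lnx : ln x = s * lf - ln L by rewrite xE ln_div ?posrE // expRK.
have lny : ln (1 - x) = s * lt - ln L by rewrite yE ln_div ?posrE // expRK.
have lnL : ln L = - (x * ln x + (1 - x) * ln (1 - x)).
  rewrite lnx lny yE xE.
  have -> : expR (s * lf) / L * (s * lf - ln L) + expR (s * lt) / L * (s * lt - ln L)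
    = (s * (expR (s * lt) * lt + expR (s * lf) * lf) - ln L * L) / L.
    by rewrite LE; field; rewrite gt_eqF // addr_gt0.
  by rewrite tilt mulr0 sub0r mulNr mulfK ?opprK // gt_eqF.
split => //.
suff : 0 < ln L by rewrite -ltr_expR expR0 lnK.
rewrite lnL.
have x01 : 0 < x < 1.
  by rewrite xE divr_gt0 //= ltr_pdivrMr // mul1r LE ltrDr.
have [x0 x1] := andP x01.
have l1 : ln x < 0 by rewrite ln_lt0.
have l2 : ln (1 - x) < 0 by rewrite ln_lt0 // subr_gt0 x1 ltrBlDr ltrDl.
nra.
Qed.

Lemma cvg_sin_div (A : R) : sin (h * A) / h @[h --> 0^'+] --> A.
Proof.
pose f (h : R) : R := sin (h * A).
have df : is_derive (0 : R) 1 f A.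
  apply: is_derive_eq; by rewrite /= !scaler0 add0r mul0r cos0 /= scaler1 mul1r.
apply: cvg_dnbhs_at_right.
have [exf dfE] := df; rewrite -[X in _ --> X]dfE /derive.
apply: cvg_trans; last exact: exf.
apply: near_eq_cvg; near=> h.
rewrite /f /= /GRing.scale /= mulr1 addr0 mul0r sin0 subr0; exact: mulrC.
Unshelve. all: by end_near. Qed.

(** For small [eta], the perturbed exponent that cancels the sine sum is given
    explicitly by [expR (s' * (A - B)) = - sin (eta * B) / sin (eta * A)], with
    [A] and [B] the two drifts. It tends to [s] as [eta] tends to 0, so the cosine
    sum tends to [L]. When the drifts vanish (equal weights) every [eta] works. *)
Lemma exists_oscillating_tilt (s La : R) :
  \sum_c expR (s * drift w c) * drift w c = 0 ->
  La < \sum_c expR (s * drift w c) ->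
  exists eta s', [/\ 0 < eta, forall c, eta * `|drift w c| <= pi / 2,
    \sum_c expR (s' * drift w c) * sin (eta * drift w c) = 0 &
    La <= \sum_c expR (s' * drift w c) * cos (eta * drift w c)].
Proof.
rewrite !big_bool /=; set A := drift w true; set B := drift w false => tilt LaL.
have eA := expR_gt0 (s * A); have eB := expR_gt0 (s * B).
have [A0|A0] := eqVneq A 0.
  have B0 : B = 0.
    by move: tilt; rewrite A0 mulr0 add0r => /eqP; rewrite mulf_eq0 gt_eqF //= => /eqP.
  exists 1, s; split => //.
  - by case; rewrite -/A -/B ?A0 ?B0 normr0 mulr0 divr_ge0 ?pi_ge0.
  - by rewrite big_bool /= -/A -/B A0 B0 !mulr0 sin0 !mulr0 addr0.
  - by rewrite big_bool /= -/A -/B; move: LaL; rewrite A0 B0 !mulr0 cos0 !mulr1 => /ltW.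
have AB : - B / A = expR (s * (A - B)).
  rewrite mulrBr expRD expRN; apply/eqP; rewrite eqr_div ?(gt_eqF eB) //; apply/eqP.
  by move: tilt; lra.
have ABn0 : A - B != 0.
  apply/eqP => AB0; move: AB; rewrite AB0 mulr0 expR0 => AB.
  have : - B = A by rewrite -[RHS]mul1r -AB divfK.
  by move=> BA; move/eqP: A0; apply; lra.
pose rho (h : R) := - (sin (h * B) / h) / (sin (h * A) / h).
pose sg (h : R) := ln (rho h) / (A - B).
have cvg_rho : rho h @[h --> 0^'+] --> expR (s * (A - B)).
  rewrite -AB; apply: cvgM; first by apply: cvgN; exact: cvg_sin_div.
  by apply: cvgV => //; exact: cvg_sin_div.
have cvg_sg : sg h @[h --> 0^'+] --> s.
  have H : (@ln R \o rho) h @[h --> 0^'+] --> ln (expR (s * (A - B))).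
    exact: (continuous_cvg _ (continuous_ln (expR_gt0 _)) cvg_rho).
  by move/(@cvgMr_tmp _ _ _ _ _ _ (A - B)^-1): H; rewrite expRK mulfK.
have cvg_id C : h * C @[h --> (0 : R)^'+] --> 0 * C.
  by apply: cvgMr_tmp; exact: cvg_at_right_filter cvg_id.
have cvg_term C : expR (sg h * C) * cos (h * C) @[h --> 0^'+] --> expR (s * C) * 1.
  rewrite -cos0 -{2}(mul0r C); apply: cvgM.
    apply: (@continuous_cvg _ _ _ _ _ (fun h => sg h * C) (@expR R)).
      exact: continuous_expR.
    exact: cvgMr_tmp.
  apply: (@continuous_cvg _ _ _ _ _ (fun h => h * C) (@cos R)); [exact: continuous_cos|exact: cvg_id].
have cvg_tot : expR (sg h * A) * cos (h * A) + expR (sg h * B) * cos (h * B)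
    @[h --> 0^'+] --> expR (s * A) + expR (s * B).
  by rewrite -[expR (s * A)]mulr1 -[expR (s * B)]mulr1; exact: cvgD.
have small C : \forall h \near (0 : R)^'+, h * `|C| <= pi / 2.
  near=> h.
  have : h * `|C| < pi / 2.
    near: h; have := cvg_id `|C|; rewrite mul0r => /cvgr_lt; apply.
    by rewrite divr_gt0 // pi_gt0.
  exact: ltW.
suff : \forall h \near (0:R)^'+, [/\ 0 < h, forall c, h * `|drift w c| <= pi / 2,
    \sum_c expR (sg h * drift w c) * sin (h * drift w c) = 0 &
    La <= \sum_c expR (sg h * drift w c) * cos (h * drift w c)].
  by move=> H; have [h [? ? ? ?]] := filter_ex H; exists h, (sg h).
near=> h.
have h0 : 0 < h by near: h; exact: nbhs_right_gt.
split => //.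
- case; rewrite -/A -/B; near: h; exact: small.
- rewrite big_bool /= -/A -/B.
  have r0 : 0 < rho h by near: h; apply: (cvgr_gt _ cvg_rho); exact: expR_gt0.
  have sA : sin (h * A) / h != 0.
    near: h; have := @cvg_sin_div A => /cvgr_neq0; exact.
  have E : expR (sg h * A) = rho h * expR (sg h * B).
    rewrite -[rho h]lnK ?posrE // -expRD; congr expR.
    by rewrite /sg; field.
  rewrite E /rho.
  have hn0 : h != 0 by rewrite gt_eqF.
  have sA0 : sin (h * A) != 0 by apply: contraNneq sA => ->; rewrite mul0r.
  by field; rewrite sA0 gt_eqF.
- rewrite big_bool /= -/A -/B; apply: ltW; near: h.
  exact: (cvgr_gt _ cvg_tot).
Unshelve. all: by end_near. Qed.

End Tilt.

(** * Regular families of words *)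

(** At each of [j] successive stages of [m] levels, the surviving vertices have
    at least [B] distinct continuation words. A tree that is regular for all [j]
    contains a [B]-ary tree of words, so no measure on the limit set is needed
    for the lower bounds. *)
Fixpoint regular (m B j : nat) (x : labelling) : bool :=
  if j is j'.+1 then (B <= nb_words (regular m B j') m x)%N else true.

Section Representatives.
Context (m : nat).

(** One vertex is chosen for each word that appears. The subtrees below the
    chosen vertices are independent given the top levels, while those below
    vertices with the same word would be counted several times. *)
Definition representative (x : labelling) (u : seq bool) : seq bool :=
  nth [::] (words m) (find (fun v => word x v == u) (words m)).

Definition representatives (x : labelling) : seq (seq bool) :=
  [seq representative x u | u <- words m & appears xpredT u x].

Lemma representativeP x u : u \in words m -> appears xpredT u x ->
  (representative x u \in words m) && (word x (representative x u) == u).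
Proof.
rewrite mem_words => /eqP su /appearsP[v [sv wv _]].
have h : has (fun v => word x v == u) (words m).
  by apply/hasP; exists v; rewrite ?mem_words ?sv ?su // wv.
by rewrite (nth_find [::] h) andbT mem_nth // -has_find.
Qed.

Lemma uniq_representatives x : uniq (representatives x).
Proof.
rewrite map_inj_in_uniq ?filter_uniq ?uniq_words // => u u'.
rewrite !mem_filter => /andP[au mu] /andP[au' mu'] E.
have /andP[_ /eqP <-] := representativeP mu au.
by have /andP[_ /eqP <-] := representativeP mu' au'; rewrite E.
Qed.

Lemma size_representatives x : size (representatives x) = nb_words xpredT m x.
Proof. by rewrite size_map size_filter. Qed.

Lemma representatives_words x v : v \in representatives x -> v \in words m.
Proof.
move=> /mapP[u]; rewrite mem_filter => /andP[au mu] ->.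
by have /andP[] := representativeP mu au.
Qed.

Lemma count_representatives (G : labelling -> bool) x :
  (count (fun v => G (subtree_at v x)) (representatives x) <= nb_words G m x)%N.
Proof.
rewrite count_map count_filter.
rewrite (@eq_in_count _ _ (fun u => (u \in words m) &&
  (G (subtree_at (representative x u) x) && appears xpredT u x))); last first.
  by move=> u ->.
apply: sub_count => u /and3P[mu Gu au].
have /andP[mr /eqP wr] := representativeP mu au.
apply/appearsP; exists (representative x u); split => //.
by move: mr mu; rewrite !mem_words => /eqP -> /eqP ->.
Qed.

Lemma representatives_depends : depends_below m representatives.
Proof.
move=> x y xy; rewrite /representatives.
have E u : u \in words m -> appears xpredT u x = appears xpredT u y.
  rewrite mem_words => /eqP su; have := @appears_depends xpredT m 0 u su.
  by rewrite addn0; apply.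
rewrite (eq_in_filter E); apply/eq_in_map => u _; rewrite /representative.
congr nth; apply: eq_in_find => v; rewrite mem_words => /eqP sv.
by rewrite (word_depends (n := m) _ xy) ?sv.
Qed.

End Representatives.

Section Regular.
Context {R : realType} (w : bool -> R).
Context (w_gt0 : forall c, 0 < w c) (w_sum : w true + w false = 1).
Let w_ge0 c : 0 <= w c := ltW (w_gt0 c).

Lemma sub_nb_words (G H : labelling -> bool) n x :
  (forall y, G y -> H y) -> (nb_words G n x <= nb_words H n x)%N.
Proof.
move=> GH; apply: sub_count => u /appearsP[v [sv wv Gv]].
by apply/appearsP; exists v; split => //; exact: GH.
Qed.

Lemma regularS m B j x : regular m B j.+1 x -> regular m B j x.
Proof.
elim: j x => [//|j IH] x /= H; apply: leq_trans H _.
by apply: sub_nb_words => y; exact: IH.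
Qed.

Lemma regularW m B i j x : (i <= j)%N -> regular m B j x -> regular m B i x.
Proof.
elim: j => [|j IH]; first by rewrite leqn0 => /eqP ->.
by rewrite leq_eqVlt ltnS => /orP[/eqP ->//|/IH ij /regularS].
Qed.

Lemma regular_depends m B j : depends_below (j * m) (regular m B j).
Proof.
elim: j => [//|j IH] x y xy /=.
by rewrite (nb_words_depends IH (x := x) (y := y)).
Qed.

(** Given the top levels, the sum over representatives is centred and has
    independent terms of variance at most [q], which makes its conditional second
    moment at most [q] times the number of representatives. *)
Lemma expect_representatives k m (G : labelling -> bool) (phi : labelling -> R) :
  depends_below m phi -> (forall x, 0 <= phi x) ->
  expect w (m + k) (fun x => phi x *
    (\sum_(v <- representatives m x) ((G (subtree_at v x))%:R - prob w k G)) ^+ 2) <=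
  expect w m (fun x => phi x * (nb_words xpredT m x)%:R) * prob w k G.
Proof.
move=> phim phi0; set q := prob w k G; pose g y : R := (G y)%:R - q.
pose r v x : R := (v \in representatives m x)%:R.
have sumr x (F : seq bool -> R) :
    \sum_(v <- representatives m x) F v = \sum_(v <- words m) r v x * F v.
  rewrite [RHS](eq_bigr (fun v => if v \in representatives m x then F v else 0)); last first.
    by move=> v _; rewrite /r; case: ifP; rewrite ?mul1r ?mul0r.
  rewrite -big_mkcond -big_filter; apply/perm_big/uniq_perm.
  - exact: uniq_representatives.
  - by rewrite filter_uniq // uniq_words.
  - move=> v; rewrite mem_filter; apply/idP/andP => [rv|[]//].
    by split => //; exact: (representatives_words rv).
have rdep v : depends_below m (r v).
  by move=> x y xy; rewrite /r (representatives_depends xy).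
have g0 : expect w k g = 0.
  by rewrite /g expectB expect_cst // subrr.
have g2 : expect w k (fun y => g y * g y) <= q.
  have -> : q = expect w k (fun y => (G y)%:R) by [].
  apply: (@le_trans _ _ (expect w k (fun y => (G y)%:R * (1 - 2 * q) + q ^+ 2))).
    by apply: le_expect => // y; rewrite /g; case: (G y) => /=; lra.
  rewrite expectD expectZr expect_cst // -/(prob w k G) -/q.
  by have := sqr_ge0 q; lra.
rewrite (eq_expect _ _ (h := fun x => \sum_(v <- words m) \sum_(v' <- words m)
    (phi x * r v x * r v' x) * g (subtree_at v x) * g (subtree_at v' x))); last first.
  move=> x; rewrite sumr expr2 big_distrl /= big_distrr /=; apply: eq_bigr => v _.
  rewrite big_distrr big_distrr /=; apply: eq_bigr => v' _; rewrite /g; ring.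
rewrite expect_sum.
apply: (@le_trans _ _ (\sum_(v <- words m) expect w m (fun x => phi x * r v x) * q)); last first.
  rewrite -big_distrl /= -expect_sum le_eqVlt; apply/orP; left; apply/eqP.
  congr (_ * _); apply: eq_expect => x; rewrite -big_distrr /=; congr (_ * _).
  rewrite -size_representatives -sum1_size natr_sum sumr.
  by apply: eq_bigr => v _; rewrite mulr1.
rewrite big_seq [leRHS]big_seq; apply: ler_sum => v mv.
have sv : size v = m by apply/eqP; rewrite -mem_words.
rewrite expect_sum (bigD1_seq v) ?uniq_words //= big_seq_cond big1 ?addr0.
  rewrite (eq_expect _ _ (h := fun x => (phi x * r v x) * (g (subtree_at v x) * g (subtree_at v x)))); last first.
    by move=> x; rewrite /r; case: (_ \in _); rewrite /=; ring.
  rewrite (expect_subtree w_sum k (fun y => g y * g y) sv); last first.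
    by move=> x y xy; rewrite (phim _ _ xy) (rdep v _ _ xy).
  apply: ler_wpM2l => //; rewrite -(expect0 w m); apply: le_expect => // x.
  by rewrite mulr_ge0 // ler0n.
move=> v' /andP[mv' vv'].
have sv' : size v' = m by apply/eqP; rewrite -mem_words.
rewrite (expect_subtree2 w_sum k g g sv sv') ?g0 ?mulr0 //; first by rewrite eq_sym.
by move=> x y xy; rewrite (phim _ _ xy) (rdep v _ _ xy) (rdep v' _ _ xy).
Qed.

(** Chebyshev's inequality, conditionally on the top [m] levels: if [t] words
    appear there and each has a good subtree below its representative with
    probability at least [q], then with conditional probability at least 1/2 at
    least [q * t / 2] of them do. *)
Lemma prob_nb_words_ge m k t B (G : labelling -> bool) (q : R) :
  0 < q -> q <= prob w k G -> 8 <= q * t%:R -> B%:R <= q * t%:R / 2 ->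
  prob w m (fun x => t <= nb_words xpredT m x)%N / 2 <=
  prob w (m + k) (fun x => B <= nb_words G m x)%N.
Proof.
move=> q0; set q' := prob w k G => qq' qt Bqt.
have q'0 : 0 < q' := lt_le_trans q0 qq'.
have t0 : 0 < t%:R :> R by rewrite ltr0n lt0n; apply/eqP => tE; move: qt; rewrite tE mulr0; lra.
pose N x : R := (nb_words xpredT m x)%:R.
(* Where [a x] is 1, missing the target [B] forces [phi x * D x ^+ 2] to be
   at least 1. *)
pose a x : R := (t <= nb_words xpredT m x)%N%:R.
pose phi x : R := a x * (4 / (q' ^+ 2 * N x ^+ 2)).
have Ndep : depends_below m (nb_words xpredT m).
  by have := @nb_words_depends xpredT m 0; rewrite addn0; apply.
have adep : depends_below m a by move=> x y xy; rewrite /a (Ndep _ _ xy).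
have phidep : depends_below m phi.
  by move=> x y xy; rewrite /phi /N (Ndep _ _ xy) (adep _ _ xy).
have phi0 x : 0 <= phi x.
  by rewrite /phi mulr_ge0 ?ler0n // divr_ge0 // mulr_ge0 // exprn_ge0 ?ler0n // ltW.
pose D x := \sum_(v <- representatives m x) ((G (subtree_at v x))%:R - q').
have dev : expect w (m + k) (fun x => phi x * D x ^+ 2) <=
    expect w m (fun x => phi x * N x) * q'.
  exact: expect_representatives.
have pt x : a x - phi x * D x ^+ 2 <= (B <= nb_words G m x)%N%:R.
  have [BN|NB] := leqP B (nb_words G m x).
    have : a x <= 1 by rewrite /a lern1 leq_b1.
    by have := mulr_ge0 (phi0 x) (sqr_ge0 (D x)); rewrite /=; lra.
  rewrite /phi /a /=; case: leqP => [tN|_]; last by rewrite !mul0r subrr.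
  have tN' : t%:R <= N x by rewrite ler_nat.
  have N0 : 0 < N x by exact: lt_le_trans tN'.
  have DE : D x = (count (fun v => G (subtree_at v x)) (representatives m x))%:R - q' * N x.
    rewrite /D sumrB -sum1_count natr_sum [in RHS]big_mkcond /=; congr (_ - _).
      by apply: eq_bigr => v _; case: (G _).
    by rewrite /N -size_representatives -sum1_size natr_sum big_distrr /=; apply: eq_bigr => v _; rewrite mulr1.
  have cB : (count (fun v => G (subtree_at v x)) (representatives m x))%:R <= B%:R :> R.
    by rewrite ler_nat (leq_trans (count_representatives _ _ _)) // ltnW.
  have qN : q * t%:R <= q' * N x by rewrite ler_pM // ltW.
  have h : q' * N x / 2 <= - D x by rewrite DE; lra.
  have qN0 : 0 < q' * N x by rewrite mulr_gt0.
  have h2 : (q' * N x) ^+ 2 <= 4 * D x ^+ 2 by nra.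
  rewrite mul1r subr_le0 mulrAC ler_pdivlMr ?mulr_gt0 ?exprn_gt0 // mul1r.
  by rewrite -exprMn.
apply: (@le_trans _ _ (expect w (m + k) (fun x => a x - phi x * D x ^+ 2))); last first.
  exact: le_expect.
rewrite expectB (expect_stable w_sum k adep).
have -> : prob w m (fun x => t <= nb_words xpredT m x)%N = expect w m a by [].
suff : expect w m (fun x => phi x * N x) * q' <= expect w m a / 2.
  by move: dev; lra.
rewrite -!expectZr; apply: le_expect => // x.
rewrite /phi /a /=; case: leqP => [tN|_]; last by rewrite !mul0r.
have tN' : t%:R <= N x by rewrite ler_nat.
have N0 : 0 < N x by exact: lt_le_trans tN'.
rewrite mul1r; have -> : 4 / (q' ^+ 2 * N x ^+ 2) * N x * q' = 4 / (q' * N x).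
  by field; rewrite !gt_eqF.
have qN : q * t%:R <= q' * N x by rewrite ler_pM // ltW.
rewrite ler_pdivrMr ?mulr_gt0 // mul1r; lra.
Qed.

(** The probability [pi / 2] is preserved by one stage, however small [pi] may
    be: it only has to be large compared with [1 / t]. This is why first moments
    are enough to build regular trees. *)
Lemma prob_regular m t B (pi : R) :
  pi <= prob w m (fun x => t <= nb_words xpredT m x)%N ->
  0 < pi -> 16 <= pi * t%:R -> B%:R <= pi * t%:R / 4 ->
  forall j, pi / 2 <= prob w (j * m) (regular m B j).
Proof.
move=> piE pi0 pit Bpi; elim=> [|j IH].
  rewrite /prob expect_cst //.
  by have := prob_le1 w_ge0 w_sum m (fun x => t <= nb_words xpredT m x)%N; lra.
apply: le_trans (@prob_nb_words_ge m (j * m) t B (regular m B j) (pi / 2) _ IH _ _); try lra.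
Qed.

(** A random integer between 0 and [2 ^ m] is at most the sum of [2 ^ i.+1] over
    the [i <= m] with [2 ^ i] below it. One of these [m + 1] dyadic levels carries
    at least a fraction [1 / (m + 1)] of the mean. *)
Lemma exists_typical_level m : exists2 t : nat, (0 < t)%N &
  expect w m (fun x => (nb_words xpredT m x)%:R) <=
  2 * (m%:R + 1) * (t%:R * prob w m (fun x => t <= nb_words xpredT m x)%N).
Proof.
pose P i := prob w m (fun x => 2 ^ i <= nb_words xpredT m x)%N.
set E := expect _ _ _.
have [i H] : exists i : nat, E <= 2 * (m%:R + 1) * ((2 ^ i)%:R * P i).
  have [//|H] := pselect (exists i : nat, E <= 2 * (m%:R + 1) * ((2 ^ i)%:R * P i)).
  have Elt i : (2 ^ i.+1)%:R * P i * (m%:R + 1) < E.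
    rewrite ltNge; apply/negP => Hi; apply: H; exists i; apply: le_trans Hi _.
    by rewrite expnS natrM; lra.
  have : E <= \sum_(i < m.+1) (2 ^ i.+1)%:R * P i.
    rewrite /P /prob; under eq_bigr do rewrite -expectZ.
    rewrite -expect_sum; apply: le_expect => // x.
    set N := nb_words _ _ _; have [->|N0] := posnP N.
      by apply: sumr_ge0 => i _; rewrite mulr_ge0 // ler0n.
    have Nm : (N <= 2 ^ m)%N by rewrite -size_words count_size.
    have im : (trunc_log 2 N < m.+1)%N.
      by rewrite ltnS -(leq_exp2l _ _ (isT : 1 < 2)%N) (leq_trans (trunc_logP _ _)).
    rewrite (bigD1 (Ordinal im)) //= trunc_logP // mulr1.
    apply: ler_wpDr; last by rewrite ler_nat ltnW // trunc_log_ltn.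
    by apply: sumr_ge0 => i _; rewrite mulr_ge0 // ler0n.
  have : \sum_(i < m.+1) (2 ^ i.+1)%:R * P i < \sum_(i < m.+1) E / (m%:R + 1).
    apply: ltr_sum => [|i _]; first by apply/hasP; exists ord0; rewrite ?mem_index_enum.
    by rewrite ltr_pdivlMr // ltr_wpDl.
  have -> : \sum_(i < m.+1) E / (m%:R + 1) = E.
    rewrite sumr_const card_ord -[LHS]mulr_natr -natr1 divfK // gt_eqF //.
  by move=> h1 h2; exfalso; lra.
by exists (2 ^ i)%N; rewrite ?expn_gt0.
Qed.

End Regular.

(** * Exponentially many words *)

Section ManyWords.
Context {R : realType} (w : bool -> R).
Context (w_gt0 : forall c, 0 < w c) (w_sum : w true + w false = 1).
Let w_ge0 c : 0 <= w c := ltW (w_gt0 c).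

(** The words whose walk stays in a fixed interval are numerous, and each of
    them appears with a probability that decays only like [1 / n]. *)
Lemma expect_nb_words_ge s (La : R) :
  \sum_c expR (s * drift w c) * drift w c = 0 ->
  0 <= La -> La < \sum_c expR (s * drift w c) ->
  exists2 c : R, 0 < c & forall n,
    c * La ^+ n / (n%:R + 1) <= expect w n (fun x => (nb_words xpredT n x)%:R).
Proof.
move=> tilt La0 LaL.
have [eta [s' [eta0 small sin0 cosL]]] := exists_oscillating_tilt tilt LaL.
pose M := pi / 2 / eta.
have M0 : 0 < M by rewrite !divr_gt0 // pi_gt0.
exists (expR (- (`|s'| * M)) * expR (- M)) => [|n]; first by rewrite mulr_gt0 ?expR_gt0.
have := @count_stays_within _ w n eta s' La 0 eta0 La0 small sin0 cosL.
rewrite -/M normr0 !mulr0 expR0 cos0 !mulr1 => /(_ (ltW M0)) H.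
have n1 : 0 < n%:R + 1 :> R by rewrite ltr_wpDl.
rewrite expect_nb_words // ler_pdivrMr //.
apply: (@le_trans _ _ (expR (- M) * (count (stays_within w M 0) (words n))%:R)).
  rewrite [X in X * _]mulrC -mulrA ler_wpM2l ?expR_ge0 //.
  by rewrite expRN ler_pdivrMl ?expR_gt0.
rewrite -sum1_count natr_sum big_distrr big_distrl /= big_mkcond /= big_seq [leRHS]big_seq.
apply: ler_sum => u; rewrite mem_words => /eqP su; case: ifP => [stay|_].
  have := appear_prob_ge w_gt0 w_sum stay; rewrite su addr0 mulr1 expRN => H1.
  by rewrite -[_^-1]mul1r ler_pdivrMr ?expR_gt0.
by rewrite mulr_ge0 ?(ltW n1) ?appear_prob_ge0.
Qed.

(** With [m] large, the mean number of words beats [La ^+ m] by a factor that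
    absorbs the losses, polynomial in [m], of [exists_typical_level] and
    [prob_regular]. *)
Lemma exists_regular s (La : R) :
  \sum_c expR (s * drift w c) * drift w c = 0 ->
  1 <= La -> La < \sum_c expR (s * drift w c) ->
  exists m B : nat, exists q : R, [/\ (0 < m)%N, La ^+ m <= B%:R, 0 < q &
    forall j, q <= prob w (j * m) (regular m B j)].
Proof.
move=> tilt La1; set L := \sum_c _ => LaL.
pose La' := (La + L) / 2.
have [c c0 Hc] : exists2 c : R, 0 < c & forall n,
    c * La' ^+ n / (n%:R + 1) <= expect w n (fun x => (nb_words xpredT n x)%:R).
  by apply: (expect_nb_words_ge tilt); rewrite -?/L /La'; lra.
have La0 : 0 < La by lra.
pose h := La' / La - 1.
have h0 : 0 < h by rewrite subr_gt0 ltr_pdivlMr // mul1r /La'; lra.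
(* The ratio [La' / La = 1 + h] has a [4 * k]-th power at least
   [k ^+ 4 * h ^+ 4], against a loss of [32 * (4 * k + 1) ^+ 2 / c], which is at
   most [800 * k ^+ 2 / c]. *)
have [K K0 KE] : exists2 K : R, 0 < K & K = 8 * 10 * 10.
  by exists (8 * 10 * 10); [lra|exact: erefl].
have ch0 : 0 < c * h ^+ 4 by apply: mulr_gt0 => //; exact: exprn_gt0.
have [k kge] : exists k : nat, K <= k.+1%:R * (c * h ^+ 4).
  exists (Num.truncn (K / (c * h ^+ 4))); rewrite -ler_pdivrMr //; apply: ltW.
  have X0 : 0 <= K / (c * h ^+ 4) by apply: divr_ge0; exact: ltW.
  by have /andP[] := truncn_itv X0.
move: k.+1 kge (ltn0Sn k) => {}k kge k0.
have k1 : 1 <= k%:R :> R by rewrite ler1n k0.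
pose m := (4 * k)%N.
have mE : m%:R = 4 * k%:R :> R by rewrite natrM.
have ratio : k%:R ^+ 4 * h ^+ 4 <= (La' / La) ^+ m.
  rewrite -exprMn /m mulnC exprM; apply: lerXn2r; rewrite ?nnegrE ?mulr_ge0 ?exprn_ge0 ?divr_ge0 //; try (rewrite /La'; lra); try lra.
  have -> : La' / La = 1 + h by rewrite /h; ring.
  apply: (@le_trans _ _ (1 + k%:R * h)); first by lra.
  elim: (k) => [|i IH]; first by rewrite mul0r expr0 addr0.
  have i0 : 0 <= i%:R :> R by rewrite ler0n.
  rewrite exprS -natr1; nra.
have big : 16 * La ^+ m <= c * La' ^+ m / (2 * (m%:R + 1) ^+ 2).
  have -> : c * La' ^+ m = (c * (La' / La) ^+ m) * La ^+ m.
    by rewrite -mulrA -exprMn divfK // gt_eqF.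
  rewrite mulrAC; apply: ler_wpM2r; first by apply: exprn_ge0; exact: ltW.
  rewrite ler_pdivlMr; last first.
    by rewrite mulr_gt0 ?exprn_gt0 // ltr_wpDl.
  apply: (@le_trans _ _ (c * (k%:R ^+ 4 * h ^+ 4))); last by rewrite ler_wpM2l // ltW.
  rewrite mE.
  have : K * k%:R ^+ 2 <= (k%:R * (c * h ^+ 4)) * k%:R ^+ 3.
    apply: (@le_trans _ _ (K * k%:R ^+ 3)); last by rewrite ler_wpM2r ?exprn_ge0.
    by apply: ler_wpM2l; [exact: ltW|rewrite [leRHS]exprSr ler_peMr ?exprn_ge0].
  have : 16 * (2 * (4 * k%:R + 1) ^+ 2) <= K * k%:R ^+ 2 :> R by rewrite KE; nra.
  have -> : (k%:R * (c * h ^+ 4)) * k%:R ^+ 3 = c * (k%:R ^+ 4 * h ^+ 4) by ring.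
  exact: le_trans.
have [t t0 Ht] := exists_typical_level w_gt0 m.
set q := prob w m _ in Ht.
have qt : 16 * La ^+ m <= q * t%:R.
  apply: le_trans big _.
  have m1 : 0 < m%:R + 1 :> R by rewrite ltr_wpDl.
  rewrite ler_pdivrMr ?mulr_gt0 ?exprn_gt0 //.
  have := le_trans (Hc m) Ht; rewrite ler_pdivrMr //.
  by move=> H; apply: le_trans H _; rewrite le_eqVlt; apply/orP; left; apply/eqP; ring.
have Lam1 : 1 <= La ^+ m by rewrite exprn_ege1.
suff main (Lm : R) : 1 <= Lm -> 16 * Lm <= q * t%:R -> exists (B : nat) (q1 : R),
    [/\ Lm <= B%:R, 0 < q1 & forall j, q1 <= prob w (j * m) (regular m B j)].
  have [B [q1 [B1 q10 Hq1]]] := main _ Lam1 qt.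
  by exists m, B, q1; split => //; rewrite muln_gt0 k0.
move=> {}Lam1 {}qt; clear big ratio.
have q0 : 0 < q.
  rewrite lt_def prob_ge0 // andbT; apply/eqP => q0; move: qt; rewrite q0 mul0r.
  by move: Lam1; lra.
have X0 : 0 <= q * t%:R / 4 by move: Lam1 qt; lra.
have /andP[] := truncn_itv X0; set B := Num.truncn _ => B1 B2.
exists B, (q / 2); split.
- by move: B2 qt Lam1; rewrite -[B.+1%:R]natr1; lra.
- by move: q0; lra.
- by apply: (prob_regular w_gt0 w_sum (lexx _) q0) => //; move: qt Lam1 B1; rewrite -?/q; lra.
Qed.

Lemma prob_none_at_level n k (G : labelling -> bool) :
  prob w (n + k) (fun x => all (fun v => ~~ G (subtree_at v x)) (words n)) =
  (1 - prob w k G) ^+ (2 ^ n).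
Proof.
elim: n => [|n IH].
  rewrite expr1 -[X in X - _](expect_cst w_sum k) -expectB; apply: eq_expect => x.
  by rewrite /= andbT; case: (G x); rewrite /= ?subrr ?subr0.
pose g x : R := (all (fun v => ~~ G (subtree_at v x)) (words n))%:R.
rewrite expnS mulnC exprM -IH.
have -> : prob w (n + k) (fun x => all (fun v => ~~ G (subtree_at v x)) (words n)) =
    \sum_c w c * expect w (n + k) g by rewrite big_bool /= -mulrDl w_sum mul1r.
rewrite -[_ ^+ 2]/(_ * _) -(expect_split w (n + k) (fun=> g) (fun=> g)).
apply: eq_expect => x; rewrite /= all_cat !all_map /g.
by do 2 case: all; rewrite ?mulr1 ?mulr0.
Qed.

End ManyWords.

(** * The law of the random labelling *)

Section Law.
Context {R : realType} (w : bool -> R).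

Definition update (x : labelling) (e : edge) (c : bool) : labelling :=
  fun e' => if e' == e then c else x e'.

(** Averaging edge by edge along an arbitrary list is what mutual independence
    gives directly; along the edges of a finite tree it agrees with [expect]. *)
Fixpoint integrate (J : seq edge) (g : labelling -> R) (x : labelling) : R :=
  if J is e :: J' then \sum_(c : bool) w c * integrate J' g (update x e c) else g x.

Definition push (a : bool) (e : edge) : edge := (a :: e.1, e.2).

Fixpoint edges_below (n : nat) : seq edge :=
  if n is n'.+1 then
    ([::], true) :: ([::], false) ::
      [seq push true e | e <- edges_below n'] ++ [seq push false e | e <- edges_below n']
  else [::].

Definition replace_subtree (a : bool) (y x : labelling) : labelling :=
  fun e => if e.1 is b :: v then (if b == a then y (v, e.2) else x e) else x e.

Lemma push_inj a : injective (push a).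
Proof. by move=> [v b] [v' b'] [-> ->]. Qed.

Lemma mem_edges_below n (e : edge) : (e \in edges_below n) = (size e.1 < n)%N.
Proof.
elim: n e => [//|n IH] [v b] /=; rewrite !inE mem_cat.
case: v => [|a v].
  by case: b; rewrite ?orbT.
have -> : ((a :: v, b) : edge) = push a (v, b) by [].
rewrite ltnS -(IH (v, b)).
have E a' : (push a (v, b) \in map (push a') (edges_below n)) =
    (a == a') && ((v, b) \in edges_below n).
  case: eqVneq => [->|/eqP aa']; first by rewrite (mem_map (@push_inj _)).
  by apply/mapP => -[e _ [/aa']].
by rewrite !E; case: a {E}; rewrite /= ?orbF.
Qed.

Lemma uniq_edges_below n : uniq (edges_below n).
Proof.
elim: n => //= n IH; rewrite inE negb_or /= !mem_cat !negb_or cat_uniq.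
rewrite !(map_inj_uniq (@push_inj _)) IH /= andbT.
do 4 (rewrite (_ : _ \notin _) /=; last by apply/mapP => -[]).
by apply/hasPn => e /mapP[e' _ ->]; apply/mapP => -[].
Qed.

Lemma integrate_cat J K g x : integrate (J ++ K) g x = integrate J (integrate K g) x.
Proof. by elim: J x => //= e J IH x; apply: eq_bigr => c _; rewrite IH. Qed.

Lemma integrate_push a J g x : integrate [seq push a e | e <- J] g x =
  integrate J (fun y => g (replace_subtree a y x)) (subtree a x).
Proof.
elim: J x => [|e J IH] x /=.
  by congr g; apply/funext => -[[|b v] c] //; rewrite /replace_subtree /=; case: eqP => // ->.
apply: eq_bigr => c _; rewrite IH.
have -> : (fun y => g (replace_subtree a y (update x (push a e) c))) =
          (fun y => g (replace_subtree a y x)).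
  apply/funext => y; congr g; apply/funext => -[[|b v] c'] //.
  rewrite /replace_subtree /=; case: eqP => // ba.
  by rewrite /update; case: eqP => // -[/ba].
congr (_ * integrate _ _ _); apply/funext => -[v b].
rewrite /subtree /update -[(a :: _, _)]/(push a (v, b)) (inj_eq (@push_inj a)) //.
Qed.

Lemma integrate_edges_below n g : integrate (edges_below n) g base_labelling = expect w n g.
Proof.
elim: n g => //= n IH g; apply: eq_bigr => c1 _; rewrite big_distrr; apply: eq_bigr => c0 _.
rewrite -mulrA; congr (_ * (_ * _)); rewrite integrate_cat integrate_push.
set b := update _ _ _.
have -> : subtree true b = base_labelling by apply/funext => -[].
rewrite -IH; congr integrate; apply/funext => x1; rewrite integrate_push.
have -> : subtree false (replace_subtree true x1 b) = base_labelling by apply/funext => -[].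
rewrite -IH; congr integrate; apply/funext => x0; congr g.
by apply/funext => -[[|[] v] []].
Qed.

Context {disp : measure_display} {T : measurableType disp} (Pr : probability T R).
Context (omega : edge -> {RV Pr >-> bool}).
Context (indep : mutually_independent Pr (fun e => omega e : T -> bool)).
Context (law : forall e c, Pr [set t | omega e t = c] = (w c)%:E).

Definition labels (t : T) : labelling := fun e => omega e t.

Lemma measurable_cylinder (K : seq edge) (k : labelling) :
  measurable [set t | forall e, e \in K -> labels t e = k e].
Proof.
elim: K => [|e K IH].
  by rewrite (_ : [set _ | _] = setT) //; apply/seteqP; split.
rewrite (_ : [set _ | _] = (omega e @^-1` [set k e]) `&`
   [set t | forall e, e \in K -> labels t e = k e]).
  by apply: measurableI => //; exact: measurable_funPTI.
apply/seteqP; split => t /=.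
  by move=> H; split => [|e' e'K]; [apply: (H e); rewrite mem_head|apply: H; rewrite inE e'K orbT].
by move=> [He HK] e'; rewrite inE => /orP[/eqP ->|/HK].
Qed.

(** Induction on the edges that are still free; those already fixed form the
    cylinder, whose probability is given by mutual independence. *)
Lemma prob_cylinder (J K : seq edge) (A : labelling -> bool) (k : labelling) :
  uniq (J ++ K) ->
  (forall x y, (forall e, e \in J ++ K -> x e = y e) -> A x = A y) ->
  measurable [set t | A (labels t) /\ forall e, e \in K -> labels t e = k e] /\
  Pr [set t | A (labels t) /\ forall e, e \in K -> labels t e = k e] =
  (integrate J (fun x => (A x)%:R) k * \prod_(e <- K) w (k e))%:E.
Proof.
elim: J K k => [|e J IH] K k /= uJK AJK.
  have AE t : (forall e, e \in K -> labels t e = k e) -> A (labels t) = A k by exact: AJK.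
  case Ak: (A k) => /=; last first.
    rewrite (_ : [set _ | _] = set0) ?measure0 ?mul0r //.
    by apply/seteqP; split => t //= -[At /AE]; rewrite At Ak.
  rewrite (_ : [set _ | _] = [set t | forall e, e \in K -> labels t e = k e]); last first.
    apply/seteqP; split => t /=; first by case.
    by move=> H; rewrite (AE t H) Ak.
  split; first exact: measurable_cylinder.
  rewrite mul1r; have := indep (A := fun e => [set k e]) uJK (fun=> _).
  rewrite (_ : [set _ | _] = [set t | forall e, e \in K -> labels t e = k e]); last first.
    apply/seteqP; split => t /= H e eK; first exact/set_mem/H.
    by apply/mem_set; exact: H.
  move=> ->; last by [].
  rewrite -prodEFin; apply: eq_bigr => e _; exact: law.
have [eJK uJK'] := andP uJK.
have perm : perm_eq (J ++ e :: K) (e :: J ++ K).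
  by rewrite -[e :: K]/([:: e] ++ K) -[e :: J ++ K]/([:: e] ++ J ++ K) perm_catCA.
have eK : e \notin K by move: eJK; rewrite mem_cat negb_or => /andP[].
pose S c := [set t | A (labels t) /\
  forall e', e' \in e :: K -> labels t e' = update k e c e'].
have {}IH c : measurable (S c) /\ Pr (S c) =
    (integrate J (fun x => (A x)%:R) (update k e c) *
     (w c * \prod_(e <- K) w (k e)))%:E.
  have [|x y xy|mS PS] := IH (e :: K) (update k e c).
  - by rewrite (perm_uniq perm).
  - by apply: AJK => e' e'm; apply: xy; rewrite (perm_mem perm).
  split=> //; rewrite PS big_cons /update eqxx; congr (_ * (_ * _))%:E.
  apply: eq_big_seq => e' e'K; case: eqP => // e'e.
  by move: eK; rewrite -e'e e'K.
have SE : [set t | A (labels t) /\ forall e', e' \in K -> labels t e' = k e'] =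
    S true `|` S false.
  have eqK c e' : e' \in K -> update k e c e' = k e'.
    by move=> e'K; rewrite /update; case: eqP => // e'e; move: eK; rewrite -e'e e'K.
  apply/seteqP; split => t /=.
    move=> [At HK].
    suff : S (labels t e) t by case: (labels t e) => ?; [left|right].
    split=> // e'; rewrite inE => /orP[/eqP ->|e'K]; first by rewrite /update eqxx.
    by rewrite eqK // HK.
  by case=> -[At HK]; split=> // e' e'K; rewrite HK ?inE ?e'K ?orbT // eqK.
rewrite SE; split; first by apply: measurableU; have [] := IH true; have [] := IH false.
have [mt Pt] := IH true; have [mf Pf] := IH false.
transitivity (Pr (S true) + Pr (S false))%E; last first.
  by rewrite Pt Pf -EFinD big_bool /=; congr _%:E; ring.
apply: measureU => //.
apply/seteqP; split => t //= -[[_ Ht] [_ Hf]].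
have := Ht e (mem_head _ _); have := Hf e (mem_head _ _).
by rewrite /update eqxx => ->.
Qed.

Lemma prob_labels n (A : labelling -> bool) : depends_below n A ->
  measurable [set t | A (labels t)] /\ Pr [set t | A (labels t)] = (prob w n A)%:E.
Proof.
move=> An; have := @prob_cylinder (edges_below n) [::] A base_labelling.
rewrite cats0 => /(_ (uniq_edges_below n)) [x y xy|].
  by apply: An => e se; apply: xy; rewrite mem_edges_below.
rewrite (_ : [set _ | _] = [set t | A (labels t)]); last first.
  by apply/seteqP; split => t /= [].
by rewrite integrate_edges_below big_nil mulr1.
Qed.

End Law.

(** * Almost sure growth of the words *)

Section AlmostSure.
Context {R : realType} (w : bool -> R).
Context (w_gt0 : forall c, 0 < w c) (w_sum : w true + w false = 1).
Context {disp : measure_display} {T : measurableType disp} (Pr : probability T R).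
Context (omega : edge -> {RV Pr >-> bool}).
Context (indep : mutually_independent Pr (fun e => omega e : T -> bool)).
Context (law : forall e c, Pr [set t | omega e t = c] = (w c)%:E).
Let w_ge0 c : 0 <= w c := ltW (w_gt0 c).

(** Markov's inequality and the Borel-Cantelli lemma. *)
Lemma ae_few_words s La : 0 <= s <= 1 -> \sum_c expR (s * drift w c) < La ->
  {ae Pr, forall t, exists n0, forall n, (n0 <= n)%N ->
    (nb_words xpredT n (labels omega t))%:R <= La ^+ n}.
Proof.
move=> s01; set L := \sum_c _ => LLa.
have L0 : 0 < L by rewrite /L big_bool addr_gt0 ?expR_gt0.
have La0 : 0 < La := lt_trans L0 LLa.
pose A n x := ~~ ((nb_words xpredT n x)%:R <= La ^+ n).
pose F n := [set t | A n (labels omega t)].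
have Adep n : depends_below n (A n).
  move=> x y xy; rewrite /A; congr (~~ (_%:R <= _)).
  by have := @nb_words_depends xpredT n 0; rewrite addn0; apply.
have mF n : measurable (F n) by have [] := prob_labels indep law (@Adep n).
pose a := L / La.
have a0 : 0 <= a by rewrite divr_ge0 ?ltW.
have a1 : a < 1 by rewrite ltr_pdivrMr // mul1r.
have PF n : (Pr (F n) <= (a ^+ n)%:E)%E.
  have [_ ->] := prob_labels indep law (@Adep n); rewrite lee_fin.
  have Lan : 0 < La ^+ n by rewrite exprn_gt0.
  apply: (@le_trans _ _ (expect w n (fun x => (nb_words xpredT n x)%:R * (La ^+ n)^-1))).
    apply: le_expect => // x; rewrite /A; case: (leP (nb_words xpredT n x)%:R (La ^+ n)) => H /=.
      by apply: divr_ge0 => //; exact: ltW.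
    by rewrite ler_pdivlMr // mul1r ltW.
  rewrite expectZr exprMn exprVn ler_wpM2r ?invr_ge0 ?(ltW Lan) //.
  exact: expect_nb_words_le.
have sumF : (\sum_(0 <= n <oo) Pr (F n) < +oo)%E.
  apply: (@le_lt_trans _ _ ((1 - a)^-1)%:E); last by rewrite ltry.
  apply: lime_le; first exact: is_cvg_nneseries.
  apply: nearW => n; apply: (@le_trans _ _ (\sum_(0 <= i < n) (a ^+ i)%:E)%E).
    exact: lee_sum.
  rewrite sumEFin lee_fin big_mkord -[leRHS]mul1r ler_pdivlMr ?subr_gt0 //.
  rewrite mulrC -opprB mulNr -subrX1 opprB gerBl; exact: exprn_ge0.
have P0 := lim_sup_set_cvg0 mF sumF.
exists (lim_sup_set F); split => //.
  apply: bigcap_measurable => // n _; exact: bigcup_measurable.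
move=> t /= H; apply: contrapT => nlim; apply: H.
have [n Hn] : exists n, forall j, (n <= j)%N -> ~ F j t.
  apply: contrapT => Hn; apply: nlim => n _; apply: contrapT => Hj.
  apply: Hn; exists n => j nj Fj; apply: Hj; by exists j.
by exists n => j /Hn /negP; rewrite negbK.
Qed.

(** The subtrees rooted at depth [n] are independent, so the probability that
    none of them is regular is at most [(1 - q) ^+ (2 ^ n)]. As regularity is
    decreasing in [j], one vertex serves all [j] simultaneously. *)
Lemma ae_regular_subtree m B (q : R) : 0 < q ->
  (forall j, q <= prob w (j * m) (regular m B j)) ->
  {ae Pr, forall t, exists v, forall j, regular m B j (subtree_at v (labels omega t))}.
Proof.
move=> q0 Hq.
pose A n j x := all (fun v => ~~ regular m B j (subtree_at v x)) (words n).
have Adep n j : depends_below (n + j * m) (A n j).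
  move=> x y xy; apply: eq_in_all => v; rewrite mem_words => /eqP sv; congr (~~ _).
  exact: (subtree_at_depends sv (@regular_depends m B j) xy).
pose F n j := [set t | A n j (labels omega t)].
have mF n j : measurable (F n j) by have [] := prob_labels indep law (@Adep n j).
have PF n j : (Pr (F n j) <= ((1 - q) ^+ n)%:E)%E.
  have [_ ->] := prob_labels indep law (@Adep n j); rewrite lee_fin.
  rewrite prob_none_at_level //.
  have P1 := prob_le1 w_ge0 w_sum (j * m) (regular m B j).
  have P2 := Hq j.
  apply: (@le_trans _ _ ((1 - q) ^+ (2 ^ n))).
    by apply: lerXn2r; rewrite ?nnegrE; lra.
  by apply: ler_wiXn2l; [lra|lra|exact/ltnW/ltn_expl].
have Fmono n : nondecreasing_seq (F n).
  move=> i j ij; apply/subsetPset => t /allP H; apply/allP => v /H.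
  by apply: contra; exact: regularW.
have PFU n : (Pr (\bigcup_j F n j) <= ((1 - q) ^+ n)%:E)%E.
  have mU : measurable (\bigcup_j F n j) by exact: bigcup_measurable.
  have H := @nondecreasing_cvg_mu _ _ _ Pr (F n) (mF n) mU (@Fmono n).
  rewrite -(cvg_lim _ H) //; apply: lime_le; first by apply/cvg_ex; eexists; exact: H.
  by apply: nearW => j; exact: PF.
have mZ : measurable (\bigcap_n \bigcup_j F n j).
  by apply: bigcapT_measurable => n; exact: bigcup_measurable.
exists (\bigcap_n \bigcup_j F n j); split => //.
  apply/eqP; rewrite eq_le measure_ge0 andbT.
  have cvg0 : ((1 - q) ^+ n)%:E @[n --> \oo] --> 0%:E.
    apply/cvg_EFin => //=; first exact: nearW.
    apply: cvg_expr; rewrite ltr_norml.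
    have P1 := prob_le1 w_ge0 w_sum (0 * m) (regular m B 0).
    by have P2 := Hq 0%N; apply/andP; split; lra.
  apply: (@le_trans _ _ (limn (fun n => ((1 - q) ^+ n)%:E))); last first.
    by rewrite (cvg_lim _ cvg0).
  apply: lime_ge; first by apply/cvg_ex; eexists; exact: cvg0.
  apply: nearW => n; apply: le_trans (PFU n); apply: le_measure; rewrite ?inE //.
  - exact: bigcup_measurable.
  - exact: bigcap_inf.
move=> t /= H n _; apply: contrapT => Hn; apply: H.
have Hj j : exists2 v, v \in words n & regular m B j (subtree_at v (labels omega t)).
  have : ~ F n j t by move=> Fj; apply: Hn; exists j.
  by move/negP; rewrite -has_predC => /hasP[v vn /=]; rewrite negbK; exists v.
apply: contrapT => Hv.
have /choice[J HJ] : forall v, exists j, ~ regular m B j (subtree_at v (labels omega t)).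
  by move=> v; apply: contrapT => Hv'; apply: Hv; exists v => j; apply: contrapT => Hr; apply: Hv'; exists j.
have [v vn] := Hj (\max_(v <- words n) J v)%N.
by move/(regularW (@leq_bigmax_seq _ _ xpredT J _ vn isT)); exact: HJ.
Qed.

End AlmostSure.

(** * Euclidean norm, similarities and packing *)

Section EuclideanNorm.
Context {R : realType} {d : nat}.
Implicit Types x y : 'rV[R]_d.

Lemma normr_coord_le x i : `|x 0 i| <= `|x|.
Proof.
rewrite [leRHS]/Num.norm /= mx_normrE.
exact: (@le_bigmax _ _ _ 0 (fun ij => `|x ij.1 ij.2|) (0, i)).
Qed.

Lemma normr_row_le x (e : R) : 0 <= e -> (forall i, `|x 0 i| <= e) -> `|x| <= e.
Proof.
move=> e0 H; rewrite [leLHS]/Num.norm /= mx_normrE; apply: bigmax_le => // -[i j] _ /=.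
by rewrite ord1.
Qed.

Lemma enorm_ge0 x : 0 <= enorm x.
Proof. exact: sqrtr_ge0. Qed.

Lemma enorm_sqr x : enorm x ^+ 2 = \sum_i x 0 i ^+ 2.
Proof. by rewrite sqr_sqrtr // sumr_ge0 // => i _; exact: sqr_ge0. Qed.

Lemma normr_le_enorm x : `|x| <= enorm x.
Proof.
apply: normr_row_le => [|i]; first exact: enorm_ge0.
rewrite -(ler_pXn2r (n := 2)) ?nnegrE ?enorm_ge0 // enorm_sqr -normrX ger0_norm ?sqr_ge0 //.
rewrite (bigD1 i) //= lerDl sumr_ge0 // => j _; exact: sqr_ge0.
Qed.

Lemma enorm_le_normr x : enorm x <= d%:R * `|x|.
Proof.
rewrite -(ler_pXn2r (n := 2)) ?nnegrE ?enorm_ge0 ?mulr_ge0 // enorm_sqr.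
apply: (@le_trans _ _ (\sum_(i < d) `|x| ^+ 2)).
  apply: ler_sum => i _; rewrite -[leLHS]ger0_norm ?sqr_ge0 // normrX.
  by rewrite lerXn2r ?nnegrE // normr_coord_le.
rewrite sumr_const card_ord -[leLHS]mulr_natl exprMn ler_wpM2r ?sqr_ge0 //.
by rewrite -natrX ler_nat; case: (d) => // n; rewrite leq_pmulr.
Qed.

Lemma enorm0 : enorm (0 : 'rV[R]_d) = 0.
Proof. by rewrite /enorm big1 ?sqrtr0 // => i _; rewrite mxE expr0n. Qed.

Lemma enormN x : enorm (- x) = enorm x.
Proof. by congr Num.sqrt; apply: eq_bigr => i _; rewrite mxE sqrrN. Qed.

End EuclideanNorm.

Section Similarity.
Context {R : realType} {d : nat} (r : R) (r_gt0 : 0 < r).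

(** Rescaled and translated to fix the origin, a similarity preserves the inner
    product by polarisation, and hence is the multiplication by an orthogonal
    matrix. *)
Lemma similarity_surj (f : 'rV[R]_d -> 'rV[R]_d) : similarity r f ->
  forall y, exists x, f x = y.
Proof.
move=> fr; pose dot (x y : 'rV[R]_d) : R := \sum_i x 0 i * y 0 i.
pose g x := r^-1 *: (f x - f 0).
have rn0 : r != 0 by rewrite gt_eqF.
have dotE x : dot x x = enorm x ^+ 2 by rewrite enorm_sqr.
have dotB x y : dot (x - y) (x - y) = dot x x - 2 * dot x y + dot y y.
  rewrite /dot mulr_sumr -sumrB -big_split /=; apply: eq_bigr => i _.
  by rewrite !mxE; ring.
have gB x y : dot (g x - g y) (g x - g y) = dot (x - y) (x - y).
  have -> : g x - g y = r^-1 *: (f x - f y).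
    by rewrite /g -scalerBr; congr (_ *: _); rewrite opprB addrA subrK.
  have E : dot (f x - f y) (f x - f y) = r ^+ 2 * dot (x - y) (x - y).
    by rewrite !dotE fr exprMn.
  transitivity (r^-1 ^+ 2 * dot (f x - f y) (f x - f y)).
    by rewrite [RHS]mulr_sumr; apply: eq_bigr => i _; rewrite !mxE; ring.
  by rewrite E mulrA -exprMn mulVf // expr1n mul1r.
have g0 : g 0 = 0 by rewrite /g subrr scaler0.
have gn x : dot (g x) (g x) = dot x x.
  by have := gB x 0; rewrite g0 !subr0.
have gdot x y : dot (g x) (g y) = dot x y.
  by have := gB x y; rewrite !dotB !gn => H; lra.
pose Q : 'M[R]_d := \matrix_(i, j) g (delta_mx 0 i) 0 j.
have dot_delta x i : dot x (delta_mx 0 i) = x 0 i.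
  rewrite /dot (bigD1 i) //= big1 ?addr0; first by rewrite mxE !eqxx mulr1.
  by move=> j ji; rewrite mxE (negbTE ji) andbF mulr0.
have gQ x : g x *m Q^T = x.
  apply/rowP => i; rewrite mxE -[RHS]dot_delta -gdot; apply: eq_bigr => j _.
  by rewrite !mxE.
have QQ : Q *m Q^T = 1%:M.
  apply/row_matrixP => i; rewrite row_mul row1.
  have -> : row i Q = g (delta_mx 0 i) by apply/rowP => j; rewrite !mxE.
  exact: gQ.
move=> y; exists ((r^-1 *: (y - f 0)) *m Q^T); set x := _ *m _.
have : g x = r^-1 *: (y - f 0).
  rewrite -[LHS]mulmx1 -(mulmx1C QQ) mulmxA gQ /x -mulmxA (mulmx1C QQ) mulmx1 //.
rewrite /g => /(scalerI (invr_neq0 rn0)) H.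
by rewrite -[f x](subrK (f 0)) H subrK.
Qed.

Lemma similarity_inj (f : 'rV[R]_d -> 'rV[R]_d) : similarity r f -> injective f.
Proof.
move=> fr x y fxy; have := fr x y; rewrite fxy subrr enorm0 => /esym/eqP.
rewrite mulf_eq0 gt_eqF //= => /eqP E; apply/eqP; rewrite -subr_eq0 -normr_eq0.
by rewrite eq_le normr_ge0 andbT -E normr_le_enorm.
Qed.

End Similarity.

Section Packing.
Context {R : realType} {d : nat}.

(** Points that are [sigma]-separated fall into different cells of a grid of
    mesh [sigma / d.+1], and the points considered occupy a box of bounded size
    in this grid. *)
Lemma packing_bound (K : R) : exists c : nat, forall (I : eqType) (s : seq I)
    (z : I -> 'rV[R]_d) (sigma : R), 0 < sigma -> uniq s ->
  {in s &, forall i j, i != j -> sigma <= enorm (z i - z j)} ->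
  {in s &, forall i j, enorm (z i - z j) <= K * sigma} ->
  (size s <= c)%N.
Proof.
pose M := (Num.truncn (2 * K * d.+1%:R)).+1.
exists (maxn 1 (#|{ffun 'I_d -> 'I_M}|)) => I [//|i0 s'] z sigma sigma0; set s := i0 :: s' => us sep diamK.
rewrite leq_max; apply/orP; right.
have i0s : i0 \in s by rewrite mem_head.
pose h := sigma / d.+1%:R.
have h0 : 0 < h by rewrite divr_gt0.
have K0 : 0 <= K.
  have := diamK i0 i0 i0s i0s; rewrite subrr enorm0 => H.
  by rewrite -(pmulr_lge0 _ sigma0).
pose y i j := (z i 0 j - z i0 0 j + K * sigma) / h.
have yb i j : i \in s -> 0 <= y i j <= 2 * K * d.+1%:R.
  move=> si; have : `|z i 0 j - z i0 0 j| <= K * sigma.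
    apply: le_trans (diamK i i0 si i0s); apply: le_trans (normr_le_enorm _).
    by have := normr_coord_le (z i - z i0) j; rewrite !mxE.
  rewrite ler_norml => /andP[H1 H2]; apply/andP; split.
    by apply: divr_ge0; lra.
  rewrite ler_pdivrMr //.
  have -> : 2 * K * d.+1%:R * h = 2 * K * sigma.
    by rewrite /h mulrA mulrAC mulfK // pnatr_eq0.
  by lra.
pose F i : {ffun 'I_d -> 'I_M} := [ffun j => inord (Num.truncn (y i j))].
have Finj : {in s &, injective F}.
  move=> i i' si si' FF; apply/eqP/negPn/negP => ii'.
  have := sep i i' si si' ii'; apply/negP; rewrite -ltNge.
  apply: le_lt_trans (enorm_le_normr _) _.
  have lt_h : `|z i - z i'| <= h.
    apply: normr_row_le => [|j]; first exact: ltW.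
    have /ffunP/(_ j) := FF; rewrite !ffunE => /(congr1 val).
    have tM k : k \in s -> (Num.truncn (y k j) < M)%N.
      by move=> sk; rewrite ltnS le_truncn //; have /andP[] := yb k j sk.
    rewrite /= !inordK ?tM // => E.
    have /andP[y0 _] := yb i j si; have /andP[y0' _] := yb i' j si'.
    have /andP[] := truncn_itv y0; have /andP[] := truncn_itv y0'.
    rewrite E -natr1 => a1 a2 a3 a4.
    have : `|y i j - y i' j| <= 1 by rewrite ler_norml; apply/andP; split; lra.
    rewrite /y -mulrBl normrM [X in _ * X]gtr0_norm ?invr_gt0 // ler_pdivrMr // mul1r.
    by rewrite !mxE; congr (`| _ | <= _); ring.
  apply: (@le_lt_trans _ _ (d%:R * h)); first by rewrite ler_wpM2l.
  by rewrite /h mulrA ltr_pdivrMr // mulrC ltr_pM2l // ltr_nat.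
rewrite -(size_map F); have : uniq (map F s) by rewrite map_inj_in_uniq.
by move=> /card_uniqP <-; exact: max_card.
Qed.

End Packing.

(** * Iterated similarities and the coding of the limit set *)

Section IteratedMaps.
Context {R : realType} {d : nat} (r : R) (r01 : 0 < r < 1).
Context (f : bool -> 'rV[R]_d -> 'rV[R]_d) (fr : forall c, similarity r (f c)).
Let r_gt0 : 0 < r. Proof. by case/andP: r01. Qed.
Let r_lt1 : r < 1. Proof. by case/andP: r01. Qed.

Fixpoint word_map (u : seq bool) (x : 'rV[R]_d) : 'rV[R]_d :=
  if u is c :: u' then f c (word_map u' x) else x.

Lemma word_map_cat u v x : word_map (u ++ v) x = word_map u (word_map v x).
Proof. by elim: u => //= c u ->. Qed.

Lemma word_map_similarity u : similarity (r ^+ size u) (word_map u).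
Proof.
by elim: u => [|c u IH] x y /=; rewrite ?expr0 ?mul1r // fr IH exprS mulrA.
Qed.

(** Images of [U] under distinct words of equal length are disjoint. A ball
    around [z] contained in [U] is mapped onto a ball, which needs surjectivity,
    and the image of [z] under another word cannot lie in this ball. *)
Lemma word_map_separated (U : set 'rV[R]_d) :
  open U -> (forall c, f c @` U `<=` U) ->
  (f true @` U) `&` (f false @` U) = set0 -> forall z, U z ->
  exists2 rho : R, 0 < rho & forall u v, size u = size v -> u != v ->
    rho * r ^+ size u <= enorm (word_map u z - word_map v z).
Proof.
move=> oU fU disj z Uz.
have wU u x : U x -> U (word_map u x).
  by move=> Ux; elim: u => //= c u IH; apply: (fU c); exists (word_map u x).
have disjoint u v x y : U x -> U y -> size u = size v ->
    word_map u x = word_map v y -> u = v.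
  move=> Ux Uy; elim: u v => [[]//|c u IH] [//|c' v] /= [suv].
  have [<- /(similarity_inj r_gt0 (fr c)) /(IH _ suv) -> //|cc' E] := eqVneq c c'.
  have : ((f true @` U) `&` (f false @` U)) (f c (word_map u x)).
    case: c c' cc' E => -[]// _ E; split.
    - by exists (word_map u x) => //; exact: wU.
    - by rewrite E; exists (word_map v y) => //; exact: wU.
    - by rewrite E; exists (word_map v y) => //; exact: wU.
    - by exists (word_map u x) => //; exact: wU.
  by rewrite disj.
have [rho /= rho0 Hrho] : exists2 rho : R, 0 < rho & forall y, enorm (y - z) < rho -> U y.
  have /nbhs_ballP[rho /= rho0 Hrho] := oU z Uz.
  exists rho => // y yz; apply: Hrho; rewrite -ball_normE /=.
  by rewrite -normrN opprB (le_lt_trans (normr_le_enorm _)).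
exists rho => // u v suv uv; rewrite leNgt; apply/negP => lt.
have ru : 0 < r ^+ size u by rewrite exprn_gt0.
have [y Ey] := similarity_surj ru (@word_map_similarity u) (word_map v z).
have Uy : U y.
  apply: Hrho; move: lt; rewrite -Ey -enormN opprB word_map_similarity.
  by rewrite [_ * enorm _]mulrC ltr_pM2r.
by move: uv; rewrite (disjoint u v y z Uy Uz suv Ey) eqxx.
Qed.

Lemma word_mapE (c : nat -> bool) n :
  \big[comp/idfun]_(k < n) f (c k) = word_map (mkseq c n) :> ('rV[R]_d -> 'rV[R]_d).
Proof.
elim: n c => [|n IH] c; first by rewrite big_ord0.
rewrite big_ord_recl.
transitivity (f (c 0%N) \o word_map (mkseq (fun k => c k.+1) n)); first by rewrite -IH.
apply/funext => x /=; congr (f _ (word_map _ _)).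
by rewrite /mkseq -[1%N]/(1 + 0)%N iotaDl -map_comp.
Qed.

Lemma word_rcons x v b : word x (rcons v b) = rcons (word x v) (x (v, b)).
Proof.
rewrite -!cats1 word_cat /=; congr (_ ++ [:: _]).
by rewrite subtree_atE /= cats0.
Qed.

Lemma word_mkseq x (beta : nat -> bool) n :
  word x (mkseq beta n) = mkseq (fun k => x (mkseq beta k, beta k)) n.
Proof. by elim: n => [//|n IH]; rewrite !mkseqS word_rcons IH. Qed.

Lemma is_path_mkseq (P : nat -> edge) : is_path P ->
  forall k, P k = (mkseq (fun k => (P k).2) k, (P k).2).
Proof.
move=> [P0 PS]; elim=> [|k IH]; first by case: (P 0%N) P0 => v b /= ->.
move: (PS k); rewrite /source /target mkseqS {1 2}IH /=.
by case: (P k.+1) => v b /= ->.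
Qed.

Lemma mkseq_is_path (beta : nat -> bool) : is_path (fun k => (mkseq beta k, beta k)).
Proof. by split => // k; rewrite /source /target /= mkseqS. Qed.

(** The increments of the orbit are bounded by a geometric sequence, so the
    orbit is Cauchy and its distance to the limit is of the order of the ratio of
    the current word map. *)
Lemma orbit_cvg (z : 'rV[R]_d) : exists2 C : R, 0 < C & forall c : nat -> bool,
  exists2 y : 'rV[R]_d, word_map (mkseq c n) 0 @[n --> \oo] --> y &
  forall n, enorm (y - word_map (mkseq c n) z) <= C * r ^+ n.
Proof.
pose M := enorm (f true 0) + enorm (f false 0).
have Mf b : enorm (f b 0) <= M by rewrite /M; case: b; rewrite ?lerDl ?lerDr enorm_ge0.
have M0 : 0 <= M by rewrite addr_ge0 ?enorm_ge0.
have r1 : 0 < 1 - r by rewrite subr_gt0.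
pose K := M / (1 - r); have K0 : 0 <= K by rewrite divr_ge0 // ltW.
exists (d%:R * (K + enorm z) + 1).
  by rewrite ltr_wpDl // mulr_ge0 // addr_ge0 ?enorm_ge0.
move=> c; pose a n := word_map (mkseq c n) 0.
have word_le b n x : `|word_map (mkseq c n) x - word_map (mkseq c n) b| <= r ^+ n * enorm (x - b).
  apply: le_trans (normr_le_enorm _) _.
  by rewrite word_map_similarity size_mkseq.
have tail n j : `|a (n + j)%N - a n| <= K * (r ^+ n - r ^+ (n + j)).
  elim: j => [|j IH]; first by rewrite addn0 !subrr normr0 mulr0.
  have step : `|a (n + j).+1 - a (n + j)%N| <= r ^+ (n + j) * M.
    rewrite /a mkseqS -cats1 word_map_cat /=; apply: le_trans (word_le _ _ _) _.
    by rewrite subr0 ler_wpM2l // exprn_ge0 // ltW.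
  rewrite addnS -[a _.+1](subrK (a (n + j)%N)) -addrA.
  apply: le_trans (ler_normD _ _) _; apply: le_trans (lerD step IH) _.
  rewrite le_eqVlt; apply/orP; left; apply/eqP; rewrite exprS.
  have -> : M = K * (1 - r) by rewrite /K divfK // gt_eqF.
  by ring.
have tail' n m : (n <= m)%N -> `|a m - a n| <= K * r ^+ n.
  move=> nm; rewrite -(subnKC nm); apply: le_trans (tail _ _) _.
  by rewrite ler_wpM2l // gerBl exprn_ge0 // ltW.
have : cvg (a @ \oo).
  apply/cauchy_cvgP/cauchy_exP => e e0.
  have : r ^+ n * (K + 1) @[n --> \oo] --> 0 * (K + 1).
    by apply: cvgMr_tmp; apply: cvg_expr; rewrite gtr0_norm.
  rewrite mul0r => /cvgr_lt /(_ _ e0) [N _ HN].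
  exists (a N); exists N => // m /= Nm; rewrite -ball_normE /= distrC.
  apply: le_lt_trans (tail' N m Nm) _; apply: le_lt_trans (HN N (leqnn N)).
  by rewrite mulrC ler_wpM2l ?lerDl // exprn_ge0 // ltW.
move=> /cvg_ex[y ay]; exists y => // n.
have yan : `|y - a n| <= K * r ^+ n.
  apply/ler_addgt0Pr => e e0.
  have /cvgrPdist_lt /(_ _ e0) [N _ HN] := ay.
  have := HN (maxn N n) (leq_maxl _ _); have := tail' n (maxn N n) (leq_maxr _ _).
  rewrite -[y - a n](subrK (a (maxn N n) - a n)) => H1 H2.
  apply: le_trans (ler_normD _ _) _; rewrite addrC lerD // ltW //.
  by rewrite opprB addrA subrK.
apply: le_trans (enorm_le_normr _) _.
have : `|y - word_map (mkseq c n) z| <= (K + enorm z) * r ^+ n.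
  rewrite -[y](subrK (a n)) -addrA; apply: le_trans (ler_normD _ _) _.
  rewrite mulrDl lerD // mulrC; apply: le_trans (word_le _ _ _) _.
  by rewrite -enormN opprB subr0.
move=> H; apply: (@le_trans _ _ (d%:R * ((K + enorm z) * r ^+ n))).
  by rewrite ler_wpM2l.
by rewrite mulrA ler_wpM2r ?lerDl // exprn_ge0 // ltW.
Qed.

(** A point of the limit set is coded by a sequence of left and right turns,
    and is approximated at rate [r ^+ n] by the image of [z] under the first [n]
    labels met. Conversely every sequence of turns codes a point. *)
Lemma generated_set_coding (z : 'rV[R]_d) : exists2 C : R, 0 < C & forall x : labelling,
  (forall y, generated_set f x y -> exists beta : nat -> bool,
    forall n, enorm (y - word_map (word x (mkseq beta n)) z) <= C * r ^+ n) /\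
  (forall beta : nat -> bool, exists2 y, generated_set f x y &
    forall n, enorm (y - word_map (word x (mkseq beta n)) z) <= C * r ^+ n).
Proof.
have [C C0 HC] := orbit_cvg z; exists C => // x; split=> [y [P pathP Py]|beta].
  exists (fun k => (P k).2) => n.
  have [y' y'lim Hy'] := HC (fun k => x (P k)).
  have -> : y = y'.
    apply: (norm_cvg_unique Py); apply: cvg_trans y'lim.
    by apply: near_eq_cvg; apply: nearW => k; rewrite (word_mapE (fun k => x (P k))).
  have := Hy' n; rewrite word_mkseq.
  have -> : (fun k => x (P k)) = (fun k => x (mkseq (fun k => (P k).2) k, (P k).2)).
    by apply/funext => k; rewrite -is_path_mkseq.
  by [].
have [y ylim Hy] := HC (fun k => x (mkseq beta k, beta k)).
exists y => [|n]; last by rewrite word_mkseq.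
exists (fun k => (mkseq beta k, beta k)); first exact: mkseq_is_path.
apply: cvg_trans ylim; apply: near_eq_cvg; apply: nearW => k.
by rewrite (word_mapE (fun k => x (mkseq beta k, beta k))).
Qed.

End IteratedMaps.

(** * Cuts of the word tree and covers of the limit set *)

Section Cuts.
Context {R : realType}.

(** A cut of a regular tree has total weight at least 1 when a word of [k]
    stages has weight [B ^- k], as each stage offers at least [B] branches, which
    share the cut among themselves. This plays the role of the mass distribution
    principle. *)
Lemma regular_cut (m B j : nat) (x : labelling) (W : seq (seq bool)) :
  (0 < m)%N -> (0 < B)%N -> regular m B j x ->
  (forall w, w \in W -> (m %| size w)%N) ->
  (forall v, size v = (j * m)%N ->
    exists2 n, (n <= size v)%N & take n (word x v) \in W) ->
  1 <= \sum_(w <- W) (B%:R : R) ^- (size w %/ m).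
Proof.
move=> m0 B0; have B0' : 0 < B%:R :> R by rewrite ltr0n.
have wt0 k : 0 <= (B%:R : R) ^- k by rewrite invr_ge0 exprn_ge0 // ltW.
have nilW W' : [::] \in W' -> 1 <= \sum_(w <- W') (B%:R : R) ^- (size w %/ m).
  move=> nW'; rewrite (big_rem [::]) //= div0n expr0 invr1 lerDl.
  by apply: sumr_ge0 => w _; exact: wt0.
elim: j x W => [|j IH] x W reg divW cut.
  by apply: nilW; have [[|n] _] := cut [::] erefl.
have [/nilW//|nilNW] := boolP ([::] \in W).
have mW w : w \in W -> (m <= size w)%N.
  move=> wW; apply: dvdn_leq (divW w wW); rewrite lt0n size_eq0.
  by apply: contraNneq nilNW => <-.
have branch u : u \in words m -> appears (regular m B j) u x ->
    B%:R^-1 <= \sum_(w <- W | take m w == u) (B%:R : R) ^- (size w %/ m).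
  rewrite mem_words => /eqP su /appearsP[v [sv wv regv]].
  have := IH _ [seq drop m w | w <- W & take m w == u] regv.
  rewrite big_map big_filter => H.
  have -> : \sum_(w <- W | take m w == u) (B%:R : R) ^- (size w %/ m) =
      B%:R^-1 * \sum_(w <- W | take m w == u) (B%:R : R) ^- (size (drop m w) %/ m).
    rewrite big_distrr /= big_seq_cond [RHS]big_seq_cond; apply: eq_bigr => w /andP[wW _].
    have := mW w wW; have /dvdnP[k Ek] := divW w wW; rewrite size_drop Ek.
    case: k {Ek} => [|k _]; first by rewrite mul0n leqNgt m0.
    by rewrite mulSn addKn -mulSn !mulnK // exprS invfM.
  rewrite -[leLHS]mulr1 ler_wpM2l ?invr_ge0 ?ler0n //; apply: H.
    move=> w /mapP[w']; rewrite mem_filter => /andP[_ wW] ->.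
    by rewrite size_drop dvdn_sub ?divW.
  move=> v' sv'; have [|n nle] := cut (v ++ v').
    by rewrite size_cat sv su sv' mulSn.
  rewrite word_cat wv => tW.
  have mn : (m <= n)%N.
    have := mW _ tW; rewrite size_take_min => /leq_trans; apply; exact: geq_minl.
  exists (n - m)%N; first by rewrite leq_subLR; move: nle; rewrite size_cat sv su.
  apply/mapP; exists (take n (u ++ word (subtree_at v x) v')).
    by rewrite mem_filter tW andbT take_takel // take_size_cat ?eqxx.
  by rewrite take_cat ltnNge su mn /= drop_size_cat.
apply: (@le_trans _ _ (\sum_(u <- words m | appears (regular m B j) u x)
   \sum_(w <- W | take m w == u) (B%:R : R) ^- (size w %/ m))).
  apply: (@le_trans _ _ (\sum_(u <- words m | appears (regular m B j) u x) (B%:R : R)^-1)).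
    rewrite big_const_seq iter_addr_0 -[leRHS]mulr_natl ler_pdivlMr // mul1r ler_nat.
    by move: reg => /=.
  by rewrite big_seq_cond [leRHS]big_seq_cond; apply: ler_sum => u /andP[]; exact: branch.
rewrite (exchange_big_dep predT) //=; apply: ler_sum => w _.
rewrite -big_filter.
have : (size [seq i <- words m | appears (regular m B j) i x & take m w == i] <= 1)%N.
  rewrite (@leq_trans (count_mem (take m w) (words m))) //.
    rewrite size_filter; apply: sub_count => u /= /andP[_ /eqP ->]; exact: eqxx.
  by rewrite count_uniq_mem ?uniq_words // leq_b1.
case: [seq _ <- _ | _] => [|a [|//]] _; rewrite ?big_nil ?big_seq1 //.
Qed.

End Cuts.

Section Covers.
Context {R : realType} {d : nat} (r : R) (r01 : 0 < r < 1).
Context (f : bool -> 'rV[R]_d -> 'rV[R]_d) (fr : forall c, similarity r (f c)).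
Let r_gt0 : 0 < r. Proof. by case/andP: r01. Qed.

Lemma enorm_le_diam (A : set 'rV[R]_d) (e : R) x y :
  (diam A <= e%:E)%E -> A x -> A y -> enorm (x - y) <= e.
Proof.
move=> Ae Ax Ay; rewrite -lee_fin; apply: le_trans Ae.
rewrite /diam le_max; apply/orP; right; apply: ereal_sup_ubound.
by exists (x, y).
Qed.

Lemma diam_ge0 (A : set 'rV[R]_d) : (0 <= diam A)%E.
Proof. by rewrite /diam le_max lexx. Qed.

Lemma diam_le (A : set 'rV[R]_d) (e : R) : 0 <= e ->
  (forall x y, A x -> A y -> enorm (x - y) <= e) -> (diam A <= e%:E)%E.
Proof.
move=> e0 H; rewrite /diam ge_max lee_fin e0 /=; apply: ge_ereal_sup => _ [[x y] [/= Ax Ay] <-].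
by rewrite lee_fin; exact: H.
Qed.

Lemma enorm_le_near (C e : R) (x y a b : 'rV[R]_d) :
  enorm (a - x) <= C -> enorm (a - b) <= e -> enorm (b - y) <= C ->
  enorm (x - y) <= d%:R * (2 * C + e).
Proof.
move=> ax ab yb; apply: le_trans (enorm_le_normr _) _; rewrite ler_wpM2l //.
have -> : x - y = - (a - x) + (a - b) + (b - y).
  by rewrite opprB -[x - a + _]addrA [- a + _]addrA [-a + a]addrC subrr add0r; rewrite addrA subrK.
apply: le_trans (ler_normD _ _) _; have := ler_normD (- (a - x)) (a - b).
rewrite normrN; have := le_trans (normr_le_enorm _) ax; have := le_trans (normr_le_enorm _) ab.
have := le_trans (normr_le_enorm _) yb; lra.
Qed.

Context (z : 'rV[R]_d) (C rho : R) (rho0 : 0 < rho).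
Context (sep : forall u v, size u = size v -> u != v ->
    rho * r ^+ size u <= enorm (word_map f u z - word_map f v z)).
Context (coding : forall (x : labelling) (beta : nat -> bool),
  exists2 y, generated_set f x y &
    forall n, enorm (y - word_map f (word x (mkseq beta n)) z) <= C * r ^+ n).

Definition words_near (w0 : seq bool) (n : nat) (D : set 'rV[R]_d) : seq (seq bool) :=
  [seq w <- words n | `[< exists2 y, D y &
      enorm (y - word_map f (w0 ++ w) z) <= C * r ^+ (size w0 + n) >]].

Lemma few_words_near : exists c : nat, forall (n : nat) (w0 : seq bool) (D : set 'rV[R]_d),
  (diam D <= (r ^+ (size w0 + n))%:E)%E ->
  (size (words_near w0 n D) <= c)%N.
Proof.
have [c Hc] := @packing_bound R d (d%:R * (2 * C + 1) / rho).
exists c => n w0 D diamD; set N := (size w0 + n)%N in diamD *.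
have rN : 0 < r ^+ N by rewrite exprn_gt0.
apply: (Hc _ _ (fun w => word_map f (w0 ++ w) z) (rho * r ^+ N)).
- by rewrite mulr_gt0.
- by rewrite filter_uniq // uniq_words.
- move=> u v; rewrite !mem_filter !mem_words => /andP[_ /eqP su] /andP[_ /eqP sv] uv.
  rewrite (_ : N = size (w0 ++ u)); last by rewrite size_cat su.
  apply: sep; first by rewrite !size_cat su sv.
  by rewrite eqseq_cat // eqxx.
- move=> u v; rewrite !mem_filter => /andP[/asboolP[y Dy yu] _] /andP[/asboolP[y' Dy' yv] _].
  rewrite mulrA divfK ?gt_eqF //.
  rewrite -mulrA mulrDl mul1r -mulrA.
  by apply: enorm_le_near yu _ yv; exact: enorm_le_diam Dy Dy'.
Qed.

(** The words near the sets of a cover meet every infinite branch. By Koenig's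
    lemma, finitely many of these sets already give a cut of the tree below [v0],
    and each contributes a bounded number of words. Working in the tree avoids
    proving that the limit set is compact and thickening the covering sets. *)
Lemma regular_cover_bound : exists2 c : R, 0 < c & forall (m B : nat) (x : labelling)
    (v0 : seq bool) (D : nat -> set 'rV[R]_d) (k : nat -> nat),
  (0 < m)%N -> (0 < B)%N -> (forall j, regular m B j (subtree_at v0 x)) ->
  generated_set f x `<=` \bigcup_i D i ->
  (forall i, D i !=set0 -> (diam (D i) <= (r ^+ (size v0 + m * k i))%:E)%E) ->
  exists I, 1 <= c * \sum_(i < I) (if D i == set0 then 0 else (B%:R : R) ^- k i).
Proof.
have [c Hc] := few_words_near.
exists (c%:R + 1) => [|m B x v0 D k m0 B0 reg cov diamD]; first by rewrite ltr_wpDl.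
pose w0 := word x v0; pose x0 := subtree_at v0 x.
have sw0 : size w0 = size v0 by rewrite size_word.
pose W i := words_near w0 (m * k i) (D i).
(* [good v] says that finitely many sets of the cover cut the tree below [v];
   if the root were not good, some infinite branch would avoid all sets. *)
pose hit I u := exists2 i, (i < I)%N & exists2 n, (n <= size u)%N & take n (word x0 u) \in W i.
have hitW I J u t : (I <= J)%N -> hit I u -> hit J (u ++ t).
  move=> IJ [i iI [n nu tW]]; exists i; first exact: leq_trans IJ.
  exists n; first by rewrite size_cat (leq_trans nu) // leq_addr.
  by rewrite word_cat takel_cat // size_word.
pose good v := exists I N, forall v', size v' = N -> hit I (v ++ v').
have [I [N HIN]] : good [::].
  apply: contrapT => bad.
  have /choice[b Hb] : forall v, exists b, ~ good v -> ~ good (rcons v b).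
    move=> v; apply: contrapT => H.
    have good_child b : good (rcons v b).
      by apply: contrapT => gb; apply: H; exists b.
    have [I1 [N1 H1]] := good_child true; have [I0 [N0 H0]] := good_child false.
    apply: H; exists true => ngv; exfalso; apply: ngv.
    exists (maxn I1 I0), (maxn N1 N0).+1 => -[//|[] v' [sv']].
    - rewrite -cat_rcons -(cat_take_drop N1 v') catA; apply: (hitW I1); first exact: leq_maxl.
      by apply: H1; rewrite size_takel // sv' leq_maxl.
    - rewrite -cat_rcons -(cat_take_drop N0 v') catA; apply: (hitW I0); first exact: leq_maxr.
      by apply: H0; rewrite size_takel // sv' leq_maxr.
  pose vs := fix vs n := if n is n'.+1 then rcons (vs n') (b (vs n')) else [::].
  have bad_vs n : ~ good (vs n) by elim: n => //= n IH; exact: Hb.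
  pose beta n := b (vs n).
  have vsE n : vs n = mkseq beta n by elim: n => // n IH; rewrite mkseqS -IH.
  pose beta' n := if (n < size v0)%N then nth true v0 n else beta (n - size v0)%N.
  have betaE n : mkseq beta' (size v0 + n) = v0 ++ mkseq beta n.
    rewrite /mkseq iotaD map_cat; congr (_ ++ _).
      rewrite -[RHS](mkseq_nth true); apply/eq_in_map => i.
      by rewrite mem_iota /beta' => /= ->.
    rewrite add0n -[X in iota X n]addn0 iotaDl -map_comp; apply: eq_map => i /=.
    by rewrite /beta' ltnNge leq_addr /= addKn.
  have [y Fy Hy] := coding x beta'.
  have [i _ Di] := cov y Fy.
  apply: (bad_vs (m * k i)%N); exists i.+1, 0%N => v' /size0nil ->; rewrite cats0.
  exists i => //; exists (m * k i)%N; first by rewrite vsE size_mkseq.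
  rewrite vsE take_oversize; last by rewrite size_word size_mkseq.
  rewrite mem_filter mem_words !size_word size_mkseq eqxx andbT.
  apply/asboolP; exists y => //.
  by have := Hy (size v0 + m * k i)%N; rewrite betaE word_cat.
have cut := @regular_cut R m B N x0 (flatten [seq W i | i <- iota 0 I]) m0 B0 (reg N).
exists I; apply: le_trans (cut _ _) _.
- move=> w /flatten_mapP[i _]; rewrite mem_filter mem_words => /andP[_ /eqP ->].
  exact: dvdn_mulr.
- move=> v sv.
  have [i iI [n nv tW]] : hit I v.
    rewrite -(cat_take_drop N v); apply: (hitW I I) => //; apply: (HIN (take N v)).
    by rewrite size_takel // sv leq_pmulr.
  exists n => //; apply/flatten_mapP; exists i => //.
  by rewrite mem_iota.
- rewrite big_flatten big_map -[I in iota 0 I]subn0 -/(index_iota 0 I) big_mkord big_distrr /=.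
  apply: ler_sum => i _.
  have EW : \sum_(w <- W i) (B%:R : R) ^- (size w %/ m) = (size (W i))%:R * (B%:R : R) ^- k i.
    rewrite -sum1_size natr_sum big_distrl /=; apply: eq_big_seq => w.
    by rewrite mem_filter mem_words mul1r => /andP[_ /eqP ->]; rewrite mulKn.
  rewrite EW; case: ifPn => [/eqP Di0|/set0P Di].
    rewrite (_ : W i = [::]) ?mul0r ?mulr0 // /W /words_near Di0 -(filter_pred0 (words (m * k i))).
    by apply: eq_filter => w; apply/asboolP => -[].
  rewrite ler_wpM2r ?invr_ge0 ?exprn_ge0 ?ler0n //.
  apply: (@le_trans _ _ c%:R); last by rewrite lerDl.
  by rewrite ler_nat Hc // sw0 diamD.
Qed.

End Covers.

(** * Dimensions from covering estimates *)

Section Dimensions.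
Context {R : realType} {d : nat} (r : R) (r01 : 0 < r < 1).
Let r_gt0 : 0 < r. Proof. by case/andP: r01. Qed.
Let r_lt1 : r < 1. Proof. by case/andP: r01. Qed.
Let kappa : R := - ln r.
Let kappa_gt0 : 0 < kappa. Proof. by rewrite oppr_gt0 ln_lt0. Qed.

Lemma exprn_ratio n : r ^+ n = expR (- (kappa * n%:R)).
Proof. by rewrite /kappa mulNr opprK expRM_natr lnK. Qed.

Lemma le_exprn_ratio (e : R) n : 0 < e -> (e <= r ^+ n) = (kappa * n%:R <= - ln e).
Proof. by move=> e0; rewrite exprn_ratio -{1}[e]lnK ?posrE // ler_expR lerNr. Qed.

Lemma slack_arith (x t e l l' k : R) : x * l <= x * l' ->
  2 * (x * (l' + k)) <= t * e -> x * (t + l + k) <= (x + e / 2) * t.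
Proof. lra. Qed.

Lemma slack_arith2 (D s t e a b l l' kap : R) :
  s * t <= s * (kap * a + kap * b) -> 2 * (s * kap * a + l') <= t * e ->
  (D - e / 2) * t <= s * t -> l <= l' -> (D - e) * t + l <= s * kap * b.
Proof. lra. Qed.

Lemma sum_initial_le (a : nat -> R) (N : nat) (b : R) : 0 <= b ->
  (forall i, a i <= if (i < N)%N then b else 0) ->
  forall k, \sum_(0 <= i < k) a i <= N%:R * b.
Proof.
move=> b0 Ha k; suff : \sum_(0 <= i < k) a i <= (minn k N)%:R * b.
  by move=> H; apply: le_trans H _; rewrite ler_wpM2r // ler_nat geq_minr.
elim: k => [|k IH]; first by rewrite big_geq // min0n mul0r.
rewrite big_nat_recr //=; apply: le_trans (lerD IH (Ha k)) _.
case: ltnP => kN.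
  by rewrite (minn_idPl kN) -natr1 mulrDl mul1r.
by rewrite addr0 (minn_idPr (leqW kN)).
Qed.

Definition extend_family (n : nat) (E : 'I_n -> set 'rV[R]_d) (i : nat) : set 'rV[R]_d :=
  if insub i is Some j then E j else set0.

Lemma extend_family_cover n (E : 'I_n -> set 'rV[R]_d) :
  \bigcup_i E i `<=` \bigcup_i extend_family E i.
Proof. by move=> y [i _ Ey]; exists i => //; rewrite /extend_family valK. Qed.

Lemma extend_family_diam n (E : 'I_n -> set 'rV[R]_d) e i : 0 <= e ->
  (forall i, (diam (E i) <= e%:E)%E) -> (diam (extend_family E i) <= e%:E)%E.
Proof.
by move=> e0 HE; rewrite /extend_family; case: insubP => // _; apply: diam_le.
Qed.

Lemma extend_family_ge n (E : 'I_n -> set 'rV[R]_d) i : (n <= i)%N -> extend_family E i = set0.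
Proof. by move=> ni; rewrite /extend_family insubN // -leqNgt. Qed.

Lemma diam_pow_ge0 s (A : set 'rV[R]_d) : (0 <= diam_pow s A)%E.
Proof. by rewrite /diam_pow; case: ifP => // _; exact: poweR_ge0. Qed.

Lemma diam_pow_le (s e : R) (A : set 'rV[R]_d) : 0 <= s -> 0 <= e ->
  (diam A <= e%:E)%E -> (diam_pow s A <= (e `^ s)%:E)%E.
Proof.
move=> s0 e0 Ae; rewrite /diam_pow; case: ifP => _; first by rewrite lee_fin powR_ge0.
rewrite -poweR_EFin; apply: gt0_ler_poweR; rewrite ?in_itv /= ?diam_ge0 ?leey ?lee_fin ?e0 //=.
Qed.

Lemma hausdorff_premeasure_ge0 s delta (F : set 'rV[R]_d) :
  (0 <= hausdorff_premeasure s delta F)%E.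
Proof.
apply: le_ereal_inf_tmp => _ [D _ <-]; apply: nneseries_ge0 => n _ _; exact: diam_pow_ge0.
Qed.

Context (F : set 'rV[R]_d) (L : R) (L1 : 1 < L).
Let D : R := ln L / kappa.
Let D_gt0 : 0 < D. Proof. by rewrite divr_gt0 // ln_gt0. Qed.
Let lnL : ln L = D * kappa. Proof. by rewrite /D divfK // gt_eqF. Qed.

Section UpperBounds.
Context (A : R) (A0 : 0 < A) (N : nat -> nat).
Context (cover : forall n, exists E : 'I_(N n) -> set 'rV[R]_d,
  F `<=` \bigcup_i E i /\ forall i, (diam (E i) <= (A * r ^+ n)%:E)%E).
Context (growth : forall La, L < La -> exists n0, forall n, (n0 <= n)%N -> (N n)%:R <= La ^+ n).

(** The covers by level [n] cells have an [s]-sum that decays geometrically as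
    soon as [s] exceeds [D]. *)
Lemma hausdorff_measure0 s : D < s -> hausdorff_measure s F = 0%E.
Proof.
move=> Ds; have s0 : 0 < s := lt_trans D_gt0 Ds.
apply/eqP; rewrite eq_le; apply/andP; split; last first.
  apply: le_trans (hausdorff_premeasure_ge0 s 1 F) _.
  apply: ereal_sup_ubound; exists 1 => //=; exact: ltr01.
apply: ge_ereal_sup => _ [delta /= delta0 <-].
apply/lee_addgt0Pr => e e0; rewrite add0e.
pose s' := (D + s) / 2.
pose La := expR (s' * kappa).
have [n0 Hn0] : exists n0, forall n, (n0 <= n)%N -> (N n)%:R <= La ^+ n.
  apply: growth; rewrite -[L]lnK ?posrE ?(lt_trans _ L1) // ltr_expR lnL.
  by rewrite ltr_pM2r // /s'; lra.
have cvg1 : A * r ^+ n @[n --> \oo] --> A * 0.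
  by apply: cvgMl_tmp; apply: cvg_expr; rewrite gtr0_norm.
pose th := expR ((s' - s) * kappa).
have th1 : th < 1 by rewrite -expR0 ltr_expR pmulr_llt0 // /s'; lra.
have cvg2 : A `^ s * th ^+ n @[n --> \oo] --> A `^ s * 0.
  by apply: cvgMl_tmp; apply: cvg_expr; rewrite gtr0_norm ?expR_gt0.
rewrite !mulr0 in cvg1 cvg2.
have [n [n0n nd ne]] : exists n, [/\ (n0 <= n)%N, A * r ^+ n <= delta & A `^ s * th ^+ n <= e].
  move: cvg1 => /cvgr_lt /(_ _ delta0) [n1 _ H1].
  move: cvg2 => /cvgr_lt /(_ _ e0) [n2 _ H2].
  exists (maxn n0 (maxn n1 n2)); split; first exact: leq_maxl.
    by apply/ltW/H1 => /=; rewrite !leq_max leqnn !orbT.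
  by apply/ltW/H2 => /=; rewrite !leq_max leqnn !orbT.
have [E [covE diamE]] := cover n.
have Arn : 0 <= A * r ^+ n by rewrite mulr_ge0 ?exprn_ge0 // ltW.
apply: (@le_trans _ _ (\sum_(0 <= i <oo) diam_pow s (extend_family E i))%E).
  apply: ereal_inf_lbound; exists (extend_family E) => //; split.
    exact: subset_trans covE (@extend_family_cover _ E).
  move=> i; apply: le_trans (extend_family_diam i Arn diamE) _.
  by rewrite lee_fin.
apply: lime_le; first by apply: is_cvg_nneseries => i _ _; exact: diam_pow_ge0.
apply: nearW => k.
apply: (@le_trans _ _ (\sum_(0 <= i < k) (if (i < N n)%N then (A * r ^+ n) `^ s else 0)%:E)%E).
  apply: lee_sum => i _; case: ltnP => iN.
    by apply: diam_pow_le => //; [exact: ltW|exact: extend_family_diam].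
  by rewrite extend_family_ge // /diam_pow eqxx.
rewrite sumEFin lee_fin; apply: le_trans ne.
apply: (@le_trans _ _ ((N n)%:R * (A * r ^+ n) `^ s)).
  by apply: sum_initial_le => [|i //]; exact: powR_ge0.
apply: (@le_trans _ _ (La ^+ n * (A * r ^+ n) `^ s)).
  by rewrite ler_wpM2r ?powR_ge0 // Hn0.
rewrite powRM ?exprn_ge0 ?(ltW A0) ?(ltW r_gt0) // mulrCA ler_wpM2l ?powR_ge0 //.
rewrite exprn_ratio -expRM -!expRM_natl -expRD ler_expR le_eqVlt; apply/orP; left; apply/eqP.
by ring.
Qed.

(** The cells of the first level with size below [delta] form a cover; the
    bounded factors are absorbed in [e], since [- ln delta] is large. *)
Lemma covering_number_le e : 0 < e -> exists2 delta0 : R, 0 < delta0 < 1 &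
  forall delta, 0 < delta < delta0 ->
  (lne (covering_number delta F) <= ((D + e) * - ln delta)%:E)%E.
Proof.
move=> e0; pose La := expR ((D + e / 2) * kappa).
have Dk : 0 < (D + e / 2) * kappa by rewrite mulr_gt0 // addr_gt0 // divr_gt0.
have [n0 Hn0] : exists n0, forall n, (n0 <= n)%N -> (N n)%:R <= La ^+ n.
  apply: growth; rewrite -[L]lnK ?posrE ?(lt_trans _ L1) // ltr_expR lnL.
  by rewrite ltr_pM2r //; lra.
pose K := (D + e / 2) * (`|ln A| + kappa).
have De : 0 < D + e / 2 by rewrite addr_gt0 // divr_gt0.
have K0 : 0 <= K.
  by apply: mulr_ge0; [exact: ltW|apply: addr_ge0 => //; exact: ltW].
have kn0 : 0 <= kappa * n0%:R by apply: mulr_ge0 => //; exact: ltW.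
have KT0 : 0 <= 2 * K / e by apply: divr_ge0; [exact: mulr_ge0|exact: ltW].
have A0' : 0 <= `|ln A| by [].
(* [- ln delta > T] ensures that the level [n] is at least [n0] and that the
   constant [K] is absorbed by [e / 2]. *)
pose T := 2 * K / e + (kappa * n0%:R + `|ln A|) + 1.
have T0 : 0 < T by rewrite /T; lra.
exists (expR (- T)); first by rewrite expR_gt0 -expR0 ltr_expR oppr_lt0.
move=> delta /andP[delta0 deltaT].
have tT : T < - ln delta.
  by rewrite ltrNr -ltr_expR lnK ?posrE.
set t := - ln delta in tT *.
have TA : kappa * n0%:R + `|ln A| <= T by rewrite /T; lra.
have TK : 2 * K / e <= T by rewrite /T; lra.
have lnA1 := ler_norm (ln A); have lnA2 := ler_norm (- ln A); rewrite normrN in lnA2.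
pose q := (t + ln A) / kappa.
have q0 : 0 <= q by apply: divr_ge0; [lra|exact: ltW].
pose n := (Num.truncn q).+1.
have /andP[n1 n2] := truncn_itv q0.
have qk : q * kappa = t + ln A by rewrite /q divfK // gt_eqF.
have n0n : (n0 <= n)%N.
  rewrite -(ler_nat R) (le_trans _ (ltW n2)) // -(ler_pM2r kappa_gt0) qk; lra.
have Arn : A * r ^+ n <= delta.
  rewrite -[A]lnK ?posrE // exprn_ratio -expRD -[delta]lnK ?posrE // ler_expR.
  have : q * kappa <= n%:R * kappa by rewrite ler_pM2r // ltW.
  by rewrite qk /t; lra.
have [E [covE diamE]] := cover n.
have le1 : (covering_number delta F <= (N n)%:R%:E)%E.
  apply: ereal_inf_lbound; exists (N n) => //; exists E; split => // i.
  by apply: le_trans (diamE i) _; rewrite lee_fin.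
have le2 : (covering_number delta F <= (expR ((D + e) * t))%:E)%E.
  apply: le_trans le1 _; rewrite lee_fin; apply: le_trans (Hn0 n n0n) _.
  rewrite -expRM_natl ler_expR.
  have : n%:R * kappa <= t + ln A + kappa.
    by rewrite /n -natr1 mulrDl mul1r lerD2r -qk ler_pM2r.
  have -> : n%:R * ((D + e / 2) * kappa) = (D + e / 2) * (n%:R * kappa) by ring.
  move=> /(ler_wpM2l (ltW De)) H; apply: le_trans H _.
  have -> : D + e = (D + e / 2) + e / 2 by rewrite -addrA -splitr.
  apply: slack_arith; last by rewrite -ler_pdivrMr //; exact: le_trans TK (ltW tT).
  by rewrite ler_wpM2l // ltW.
have cov0 : (0 <= covering_number delta F)%E.
  by apply: le_ereal_inf_tmp => _ [n' _ <-]; rewrite lee_fin.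
have -> : ((D + e) * t)%:E = lne (expR ((D + e) * t))%:E by rewrite lne_EFin ?expR_gt0 // expRK.
by rewrite lee_lne // in_itv /= ?cov0 ?leey // lee_fin expR_ge0.
Qed.

End UpperBounds.

Section LowerBounds.
Context (c : R) (c0 : 0 < c).
Context (cover_ge : forall La, 1 <= La -> La < L -> exists m B n0 : nat,
  [/\ (0 < m)%N, La ^+ m <= B%:R &
   forall (E : nat -> set 'rV[R]_d) (k : nat -> nat), F `<=` \bigcup_i E i ->
   (forall i, E i !=set0 -> (diam (E i) <= (r ^+ (n0 + m * k i))%:E)%E) ->
   exists I, 1 <= c * \sum_(i < I) (if E i == set0 then 0 else (B%:R : R) ^- k i)]).

(** A covering set is compared with a level of the tree: the last level whose
    cells are at least as large as the set. When the set has diameter 0 there is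
    no such level, and a level deep enough for the weight to be below [eta] is
    taken instead. *)
Lemma exists_level (m n0 B : nat) (s eta : R) (A : set 'rV[R]_d) :
  (0 < m)%N -> (1 < B)%N -> 0 <= s -> 0 < eta -> expR (s * kappa) ^+ m <= B%:R ->
  (diam A <= (r ^+ n0)%:E)%E ->
  exists2 k : nat, (diam A <= (r ^+ (n0 + m * k))%:E)%E &
    A !=set0 -> (B%:R : R) ^- k <=
      expR (s * kappa * (n0 + m)%:R) * fine (diam_pow s A) + eta.
Proof.
move=> m0 B1 s0 eta0 sB.
have B0 : 0 < B%:R :> R by rewrite ltr0n ltnW.
rewrite /diam_pow; have := @diam_ge0 R d A; case: (diam A) => [De| |] //; rewrite !lee_fin => De0 DeA.
have [De_eq0|Den0] := eqVneq De 0.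
  pose k := (Num.truncn eta^-1).+1.
  exists k; first by rewrite De_eq0 lee_fin exprn_ge0 // ltW.
  move=> _; apply: (@le_trans _ _ eta); last first.
    rewrite lerDr mulr_ge0 ?expR_ge0 //; case: ifP => // _.
    by rewrite poweR_EFin /= powR_ge0.
  rewrite invf_ple ?posrE ?exprn_gt0 //.
  apply: (@le_trans _ _ k%:R).
    have eta0' : 0 <= eta^-1 by rewrite invr_ge0 ltW.
    by apply: ltW; have /andP[] := truncn_itv eta0'.
  by rewrite -natrX ler_nat ltnW // ltn_expl.
have Dpos : 0 < De by rewrite lt_def Den0.
have Dln N : (De <= r ^+ N) = (kappa * N%:R <= - ln De) by exact: le_exprn_ratio.
have ex : exists k, De > r ^+ (n0 + m * k.+1).
  exists (Num.truncn (`|ln De| / kappa)); rewrite ltNge Dln -ltNge.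
  have q0 : 0 <= `|ln De| / kappa by rewrite divr_ge0 // ltW.
  have /andP[_] := truncn_itv q0; set k := Num.truncn _.
  rewrite ltr_pdivrMr // => H.
  have lnDe := ler_norm (- ln De); rewrite normrN in lnDe.
  apply: le_lt_trans lnDe _; apply: lt_le_trans H _.
  rewrite mulrC ler_wpM2l ?(ltW kappa_gt0) // ler_nat.
  by apply: leq_trans (leq_addl _ _); exact: leq_pmull.
case: (ex_minnP ex) => k Hk mink; exists k.
  case: k Hk mink => [|k] Hk mink; first by rewrite muln0 addn0 lee_fin.
  by rewrite lee_fin leNgt; apply/negP => /mink; rewrite ltnn.
move=> /set0P An0; rewrite (negbTE An0) poweR_EFin /= /powR (negbTE Den0).
apply: (@le_trans _ _ (expR (- (s * kappa * (m * k)%:R)))).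
  rewrite expRN lef_pV2 ?posrE ?expR_gt0 ?exprn_gt0 // expRM_natr exprM.
  by apply: lerXn2r; rewrite ?nnegrE ?exprn_ge0 ?expR_ge0 // ltW.
apply: ler_wpDr; first exact: ltW.
rewrite -expRD ler_expR.
move: Hk; rewrite ltNge Dln -ltNge => Hk.
have : s * - ln De <= s * (kappa * (n0 + m * k.+1)%:R) by rewrite ler_wpM2l // ltW.
by rewrite mulnS !natrD; lra.
Qed.

(** If the measure vanished, some cover would have an arbitrarily small
    [s]-sum, and a cut of total weight less than 1 would follow. The errors of
    [exists_level] are summed along a geometric sequence. *)
Lemma hausdorff_measure_neq0 s : 0 <= s -> s < D -> hausdorff_measure s F <> 0%E.
Proof.
move=> s0 sD Hs0; pose s' := (s + D) / 2.
have [m [B [n0 [m0 LaB cov]]]] : exists m B n0 : nat,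
  [/\ (0 < m)%N, expR (s' * kappa) ^+ m <= B%:R &
   forall (E : nat -> set 'rV[R]_d) (k : nat -> nat), F `<=` \bigcup_i E i ->
   (forall i, E i !=set0 -> (diam (E i) <= (r ^+ (n0 + m * k i))%:E)%E) ->
   exists I, 1 <= c * \sum_(i < I) (if E i == set0 then 0 else (B%:R : R) ^- k i)].
  apply: cover_ge.
    by rewrite -expR0 ler_expR mulr_ge0 ?(ltW kappa_gt0) // /s'; lra.
  by rewrite -[L]lnK ?posrE ?(lt_trans _ L1) // ltr_expR lnL ltr_pM2r // /s'; lra.
have B1 : (1 < B)%N.
  rewrite -(ltr_nat R); apply: lt_le_trans LaB.
  rewrite exprn_egt1 -?lt0n // -expR0 ltr_expR mulr_gt0 //.
  by rewrite /s'; lra.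
have sB : expR (s * kappa) ^+ m <= B%:R.
  apply: le_trans LaB; apply: lerXn2r; rewrite ?nnegrE ?expR_ge0 // ler_expR.
  by rewrite ler_pM2r // /s'; lra.
pose K := expR (s * kappa * (n0 + m)%:R).
have K0 : 0 < K by exact: expR_gt0.
pose eta := (c * (K + 1))^-1.
have eta0 : 0 < eta by rewrite invr_gt0 mulr_gt0 // addr_gt0.
have : (hausdorff_premeasure s (r ^+ n0) F < eta%:E)%E.
  apply: (@le_lt_trans _ _ 0%E); last by rewrite lte_fin.
  rewrite -Hs0; apply: ereal_sup_ubound; exists (r ^+ n0) => //=.
  exact: exprn_gt0.
move=> /ereal_inf_lt[_ [E [covE diamE] <-] sumE].
pose e i := fine (diam_pow s (E i)).
have powE i : diam_pow s (E i) = (e i)%:E.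
  rewrite fineK // ge0_fin_numE ?diam_pow_ge0 //.
  have := @diam_pow_le s (r ^+ n0) (E i) s0 (exprn_ge0 _ (ltW r_gt0)) (diamE i).
  by move=> /le_lt_trans; apply; rewrite ltry.
have e0 i : 0 <= e i by rewrite -lee_fin -powE diam_pow_ge0.
have /choice[k Hk] : forall i, exists k, (diam (E i) <= (r ^+ (n0 + m * k))%:E)%E /\
    (E i !=set0 -> (B%:R : R) ^- k <= K * e i + eta * 2^-1 ^+ i.+1).
  move=> i; have h0 : 0 < eta * 2^-1 ^+ i.+1 by rewrite mulr_gt0 // exprn_gt0 // invr_gt0.
  by have [k H1 H2] := exists_level m0 B1 s0 h0 sB (diamE i); exists k.
have [|I] := cov E k covE _; first by move=> i _; have [] := Hk i.
apply/negP; rewrite -ltNge.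
have sume : \sum_(i < I) e i < eta.
  rewrite -lte_fin; apply: le_lt_trans sumE; rewrite -sumEFin -(big_mkord predT (fun i => (e i)%:E)).
  under eq_bigr do rewrite -powE.
  by apply: nneseries_lim_ge => i _ _; exact: diam_pow_ge0.
have sumg : \sum_(i < I) (2^-1 : R) ^+ i.+1 <= 1.
  have -> : \sum_(i < I) (2^-1 : R) ^+ i.+1 = 1 - 2^-1 ^+ I.
    elim: I {sume} => [|I IH]; first by rewrite big_ord0 expr0 subrr.
    by rewrite big_ord_recr /= IH exprS; lra.
  by rewrite gerBl exprn_ge0 // invr_ge0.
apply: (@le_lt_trans _ _ (c * (K * \sum_(i < I) e i + eta * \sum_(i < I) 2^-1 ^+ i.+1))).
  rewrite ler_wpM2l ?(ltW c0) // !big_distrr -big_split /=; apply: ler_sum => i _.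
  case: ifPn => [_|/set0P Ei]; last by have [_] := Hk i; apply.
  apply: addr_ge0; first by rewrite mulr_ge0 // ltW.
  by apply: mulr_ge0; [exact: ltW|rewrite exprn_ge0 // invr_ge0].
apply: (@lt_le_trans _ _ (c * (K * eta + eta * 1))).
  rewrite ltr_pM2l // ltr_leD ?ltr_pM2l // ler_wpM2l // ltW //.
have -> : c * (K * eta + eta * 1) = c * (K + 1) * eta by ring.
by rewrite /eta mulfV // gt_eqF // mulr_gt0 // addr_gt0.
Qed.

(** A cover by [n] sets of diameter at most [delta] gives a cut made of boundedly
    many words per set, all of the same level. Hence [n] is at least of the order
    of [B ^+ k] at the level [k] where cells have size about [delta]. *)
Lemma covering_number_ge e : 0 < e -> exists2 delta0 : R, 0 < delta0 < 1 &
  forall delta, 0 < delta < delta0 ->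
  (((D - e) * - ln delta)%:E <= lne (covering_number delta F))%E.
Proof.
move=> e0; (* The maximum keeps the branching rate at least 1 when [e] is large. *)
pose s := Num.max 0 (D - e / 2).
have s0 : 0 <= s by rewrite le_max lexx.
have sD : s < D by rewrite gt_max D_gt0 /=; lra.
have se : D - e / 2 <= s by rewrite le_max lexx orbT.
have [m [B [n0 [m0 LaB cov]]]] : exists m B n0 : nat,
  [/\ (0 < m)%N, expR (s * kappa) ^+ m <= B%:R &
   forall (E : nat -> set 'rV[R]_d) (k : nat -> nat), F `<=` \bigcup_i E i ->
   (forall i, E i !=set0 -> (diam (E i) <= (r ^+ (n0 + m * k i))%:E)%E) ->
   exists I, 1 <= c * \sum_(i < I) (if E i == set0 then 0 else (B%:R : R) ^- k i)].
  apply: cover_ge.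
    by rewrite -expR0 ler_expR mulr_ge0 // ltW.
  by rewrite -[L]lnK ?posrE ?(lt_trans _ L1) // ltr_expR lnL ltr_pM2r.
have B0 : 0 < B%:R :> R by apply: lt_le_trans LaB; rewrite exprn_gt0 // expR_gt0.
pose K := s * kappa * (n0 + m)%:R + `|ln c|.
have K0 : 0 <= K by rewrite addr_ge0 // !mulr_ge0 // ltW.
have KT0 : 0 <= 2 * K / e by apply: divr_ge0; [exact: mulr_ge0|exact: ltW].
have kn0 : 0 <= kappa * n0%:R by apply: mulr_ge0 => //; exact: ltW.
(* [- ln delta > T] ensures that some level is coarser than [delta] and that
   the constant [K] is absorbed by [e / 2]. *)
pose T := 2 * K / e + kappa * n0%:R + 1.
have T0 : 0 < T by rewrite /T; lra.
exists (expR (- T)); first by rewrite expR_gt0 -expR0 ltr_expR oppr_lt0.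
move=> delta /andP[delta0 deltaT].
have tT : T < - ln delta by rewrite ltrNr -ltr_expR lnK ?posrE.
have [t tE] : exists t, t = - ln delta by exists (- ln delta).
rewrite -tE in tT *.
have TA : kappa * n0%:R <= T by rewrite /T; lra.
have TK : 2 * K / e <= T by rewrite /T; lra.
have mpos : 0 < m%:R :> R by rewrite ltr0n.
pose q := (t / kappa - n0%:R) / m%:R.
have q0 : 0 <= q.
  apply: divr_ge0; last exact: ltW.
  by rewrite subr_ge0 ler_pdivlMr // mulrC; lra.
pose k := Num.truncn q.
have /andP[k1 k2] := truncn_itv q0; rewrite -/k in k1 k2.
have qE : kappa * (n0%:R + m%:R * q) = t.
  by rewrite /q [m%:R * _]mulrC divfK ?gt_eqF // addrC subrK mulrC divfK // gt_eqF.
have delta_le : delta <= r ^+ (n0 + m * k).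
  rewrite le_exprn_ratio // -tE -qE ler_pM2l // natrD natrM lerD2l ler_pM2l //.
have key (n : nat) (E : 'I_n -> set 'rV[R]_d) : F `<=` \bigcup_i E i ->
    (forall i, (diam (E i) <= delta%:E)%E) -> expR ((D - e) * t) <= n%:R.
  move=> covE diamE.
  have [||I] := cov (extend_family E) (fun=> k).
  - exact: subset_trans covE (@extend_family_cover _ E).
  - move=> i _; apply: le_trans (extend_family_diam i (ltW delta0) diamE) _.
    by rewrite lee_fin.
  have Bk : 0 < (B%:R : R) ^- k by rewrite invr_gt0 exprn_gt0.
  have := @sum_initial_le (fun i => if extend_family E i == set0 then 0 else (B%:R : R) ^- k)
     n ((B%:R : R) ^- k) (ltW Bk) _ I; rewrite big_mkord => sumle H1.
  have {}H1 : 1 <= c * (n%:R * (B%:R : R) ^- k).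
    apply: le_trans H1 _; rewrite ler_pM2l //; apply: sumle => i.
    case: ltnP => [_|ni]; first by case: ifP => _ //; exact: ltW.
    by rewrite extend_family_ge // eqxx.
  have {}H1 : B%:R ^+ k / c <= n%:R.
    rewrite ler_pdivrMr // -[leLHS]mul1r -ler_pdivlMr ?exprn_gt0 //.
    by apply: le_trans H1 _; rewrite mulrA [c * _]mulrC.
  apply: le_trans H1; rewrite ler_pdivlMr // -{1}[c]lnK ?posrE // -expRD.
  apply: (@le_trans _ _ (expR (s * kappa * (m * k)%:R))); last first.
    by rewrite expRM_natr exprM; apply: lerXn2r; rewrite ?nnegrE ?exprn_ge0 ?expR_ge0.
  rewrite ler_expR.
  have lnc := ler_norm (ln c).
  have h1 : t <= kappa * (n0 + m)%:R + kappa * (m * k)%:R.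
    rewrite -qE -mulrDr ler_pM2l // natrD natrM -addrA lerD2l -[X in X + _]mulr1 -mulrDr ler_pM2l //.
    by rewrite addrC natr1 ltW.
  have h2 : 2 * K <= t * e by rewrite -ler_pdivrMr //; exact: le_trans TK (ltW tT).
  have h3 : (D - e / 2) * t <= s * t by rewrite ler_wpM2r // ltW // (lt_trans T0).
  move: (ler_wpM2l s0 h1) h2 h3 lnc; rewrite /K; exact: slack_arith2.
have le2 : ((expR ((D - e) * t))%:E <= covering_number delta F)%E.
  apply: le_ereal_inf_tmp => _ [n [E [covE diamE]] <-]; rewrite lee_fin.
  exact: key covE diamE.
have -> : ((D - e) * t)%:E = lne (expR ((D - e) * t))%:E by rewrite lne_EFin ?expR_gt0 // expRK.
rewrite lee_lne // in_itv /= leey andbT ?lee_fin ?expR_ge0 //.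
by apply: le_trans le2; rewrite lee_fin expR_ge0.
Qed.

End LowerBounds.

End Dimensions.

(** * Hausdorff and box dimension *)

Section Conclusions.
Context {R : realType} {d : nat} (F : set 'rV[R]_d) (D : R).

Lemma hausdorff_dim_eq : 0 <= D ->
  (forall s, D < s -> hausdorff_measure s F = 0%E) ->
  (forall s, 0 <= s -> s < D -> hausdorff_measure s F <> 0%E) ->
  hausdorff_dim F = D%:E.
Proof.
move=> D0 above below; apply/eqP; rewrite eq_le; apply/andP; split.
  apply/lee_addgt0Pr => e e0; rewrite -EFinD.
  apply: ereal_inf_lbound; exists (D + e) => //=; split; first lra.
  by apply: above; lra.
apply: le_ereal_inf_tmp => _ [s [s0 Hs] <-]; rewrite lee_fin leNgt; apply/negP => sD.
exact: below s0 sD Hs.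
Qed.

(** The logarithm of the covering number has to be shown finite for small
    [delta], as the limit is taken in the extended reals. *)
Lemma has_box_dim_eq :
  (forall e, 0 < e -> exists2 delta0 : R, 0 < delta0 < 1 &
    forall delta, 0 < delta < delta0 ->
    (lne (covering_number delta F) <= ((D + e) * - ln delta)%:E)%E) ->
  (forall e, 0 < e -> exists2 delta0 : R, 0 < delta0 < 1 &
    forall delta, 0 < delta < delta0 ->
    (((D - e) * - ln delta)%:E <= lne (covering_number delta F))%E) ->
  has_box_dim F D%:E.
Proof.
move=> above below.
pose g delta := (lne (covering_number delta F) * ((- ln delta)^-1)%:E)%E.
have bounds e : 0 < e -> \forall delta \near 0^'+,
    g delta \is a fin_num /\ `|D - fine (g delta)| <= e.
  move=> e0; have [d1 /andP[d10 d11] H1] := above e e0; have [d2 /andP[d20 d21] H2] := below e e0.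
  near=> delta.
  have delta0 : 0 < delta by near: delta; exact: nbhs_right_gt.
  have dd1 : delta < d1 by near: delta; exact: nbhs_right_lt.
  have dd2 : delta < d2 by near: delta; exact: nbhs_right_lt.
  have := H1 delta; rewrite delta0 dd1 => /(_ isT); have := H2 delta; rewrite delta0 dd2 => /(_ isT).
  have t0 : 0 < - ln delta by rewrite oppr_gt0 ln_lt0 // delta0 (lt_trans dd1).
  rewrite /g; move: (- ln delta) t0 => t t0.
  case: (lne _) => [v| |]; rewrite ?lee_fin ?leeNy_eq ?leye_eq // => v1 v2.
  rewrite -EFinM; split=> //=.
  have v1' : D - e <= v / t by rewrite ler_pdivlMr.
  have v2' : v / t <= D + e by rewrite ler_pdivrMr.
  by rewrite ler_norml; apply/andP; split; lra.
rewrite /has_box_dim -/g; apply/fine_cvgP; split.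
  by have := bounds 1 ltr01; apply: filterS => delta [].
apply/cvgrPdist_le => e e0; have := bounds e e0; apply: filterS => delta [_].
by [].
Unshelve. all: by end_near. Qed.

End Conclusions.

(* The label [true] stands for 1 and [false] for 2. *)
Theorem theorem1p1 (R : realType) (d : nat) (r : R)
    (f1 f2 : 'rV[R]_d -> 'rV[R]_d) (U : set 'rV[R]_d)
    (disp : measure_display) (T : measurableType disp) (Pr : probability T R)
    (p : R) (omega : edge -> {RV Pr >-> bool})
    (hr : 0 < r < 1)
    (hf1 : similarity r f1) (hf2 : similarity r f2)
    (U_nonempty : U !=set0) (U_bounded : bounded_set U) (U_open : open U)
    (U_f1 : f1 @` U `<=` U) (U_f2 : f2 @` U `<=` U)
    (U_disj : (f1 @` U) `&` (f2 @` U) = set0)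
    (U_regular : U = interior (closure U))
    (hp : 0 < p < 1)
    (omega_indep :
       mutually_independent Pr (fun e => omega e : T -> bool))
    (omega1 : forall e, Pr [set t | omega e t = true] = p%:E)
    (omega2 : forall e, Pr [set t | omega e t = false] = (1 - p)%:E) :
  let D : R :=
    (xi p * ln (xi p) + (1 - xi p) * ln (1 - xi p)) / ln r in
  {ae Pr, forall t,
    let F := generated_set (fun b : bool => if b then f1 else f2)
               (fun e => omega e t) in
    hausdorff_dim F = D%:E /\ has_box_dim F D%:E}.
Proof.
pose w (c : bool) : R := if c then p else 1 - p.
have /andP[p0 p1] := hp.
have w_gt0 c : 0 < w c by case: c; rewrite /w ?subr_gt0.
have w_sum : w true + w false = 1 by rewrite /w addrC subrK.
have law e c : Pr [set t | omega e t = c] = (w c)%:E by case: c; rewrite /w ?omega1 ?omega2.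
have [s s01 tilt] := exists_tilt w_gt0 w_sum.
have [L1 lnL] := entropy_tilt w_gt0 w_sum tilt.
set L := \sum_c _ in L1 lnL.
pose f (b : bool) := if b then f1 else f2.
have fr c : similarity r (f c) by case: c.
have [z Uz] := U_nonempty.
have [C C0 coding] := generated_set_coding hr fr z.
have fU c : f c @` U `<=` U by case: c.
have [rho rho0 sep] := word_map_separated hr fr U_open fU U_disj Uz.
have [c c0 cover_bound] := regular_cover_bound hr rho0 sep (fun x => (coding x).2).
(* What the limit set needs to know about the labels; it holds almost surely,
   and the rest of the proof is deterministic. *)
pose few t := forall La, L < La -> exists n0, forall n, (n0 <= n)%N ->
  (nb_words xpredT n (labels omega t))%:R <= La ^+ n.
pose many t := forall La, 1 <= La -> La < L -> exists m B v, [/\ (0 < m)%N,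
  La ^+ m <= B%:R & forall j, regular m B j (subtree_at v (labels omega t))].
have ae_few : {ae Pr, forall t, few t}.
  (* Countably many rates decreasing to [L] are enough. *)
  have H : {ae Pr, forall t, forall i : nat, exists n0, forall n, (n0 <= n)%N ->
      (nb_words xpredT n (labels omega t))%:R <= (L + i.+1%:R^-1) ^+ n}.
    apply: ae_foralln => i; apply: (ae_few_words w_gt0 w_sum omega_indep law s01).
    by rewrite ltrDl.
  apply: filterS H => t H La LLa.
  have [i Hi] : exists i : nat, L + i.+1%:R^-1 <= La.
    have e0 : 0 < La - L by rewrite subr_gt0.
    have e0' : 0 <= (La - L)^-1 by rewrite invr_ge0 ltW.
    exists (Num.truncn (La - L)^-1); rewrite -lerBrDl invf_ple ?posrE //.
    by have /andP[_ /ltW] := truncn_itv e0'.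
  have [n0 Hn0] := H i; exists n0 => n /Hn0 /le_trans; apply.
  have L0 : 0 < L := lt_trans ltr01 L1.
  apply: lerXn2r => //; rewrite nnegrE ltW //; last exact: lt_trans LLa.
  by rewrite addr_gt0 // invr_gt0.
have ae_many : {ae Pr, forall t, many t}.
  have H : {ae Pr, forall t, forall i : nat, 1 <= L - i.+1%:R^-1 -> exists m B v,
      [/\ (0 < m)%N, (L - i.+1%:R^-1) ^+ m <= B%:R &
      forall j, regular m B j (subtree_at v (labels omega t))]}.
    apply: ae_foralln => i.
    have [La1|La1] := leP 1 (L - i.+1%:R^-1); last first.
      exact: aeW.
    have LaL : L - i.+1%:R^-1 < L by rewrite gtrBl.
    have [m [B [q [m0 LaB q0 Hq]]]] := exists_regular w_gt0 w_sum tilt La1 LaL.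
    have := ae_regular_subtree w_gt0 w_sum omega_indep law q0 Hq.
    by apply: filterS => t [v Hv] _; exists m, B, v.
  apply: filterS H => t H La La1 LaL.
  have [i Hi] : exists i : nat, La <= L - i.+1%:R^-1.
    have e0 : 0 < L - La by rewrite subr_gt0.
    have e0' : 0 <= (L - La)^-1 by rewrite invr_ge0 ltW.
    exists (Num.truncn (L - La)^-1); rewrite lerBrDl -lerBrDr invf_ple ?posrE //.
    by have /andP[_ /ltW] := truncn_itv e0'.
  have [m [B [v [m0 LaB reg]]]] := H i (le_trans La1 Hi).
  exists m, B, v; split=> //; apply: le_trans LaB.
  have La0 : 0 <= La := le_trans ler01 La1.
  by apply: lerXn2r; rewrite ?nnegrE // (le_trans La0).
move=> D; have DE : D = ln L / - ln r.
  by rewrite invrN mulrN -mulNr lnL opprK.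
have lnr0 : 0 < - ln r by rewrite oppr_gt0 ln_lt0.
have D0 : 0 <= D by rewrite DE divr_ge0 ?ltW // ln_gt0.
apply: filterS2 ae_few ae_many => t few_t many_t /=; set F := generated_set _ _.
have [r0 r1] := andP hr.
have A0 : 0 < d%:R * (2 * C) + 1 by rewrite ltr_wpDl // !mulr_ge0 // ltW.
have cover n : exists E : 'I_(nb_words xpredT n (labels omega t)) -> set 'rV[R]_d,
  F `<=` \bigcup_i E i /\ forall i, (diam (E i) <= ((d%:R * (2 * C) + 1) * r ^+ n)%:E)%E.
  pose W := [seq u <- words n | appears xpredT u (labels omega t)].
  have sW : size W = nb_words xpredT n (labels omega t) by rewrite size_filter.
  pose E (i : 'I_(nb_words xpredT n (labels omega t))) : set 'rV[R]_d :=
    [set y | enorm (y - word_map f (nth [::] W i) z) <= C * r ^+ n].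
  exists E; split.
    move=> y Fy; have [beta Hbeta] := (coding (labels omega t)).1 y Fy.
    pose u := word (labels omega t) (mkseq beta n).
    have uW : u \in W.
      rewrite mem_filter mem_words size_word size_mkseq eqxx andbT.
      by apply/appearsP; exists (mkseq beta n); rewrite size_word.
    have iu : (index u W < nb_words xpredT n (labels omega t))%N by rewrite -sW index_mem.
    by exists (Ordinal iu) => //; rewrite /E /= nth_index //; exact: Hbeta.
  have rn0 : 0 <= r ^+ n by rewrite exprn_ge0 // ltW.
  move=> i; apply: diam_le; first by rewrite mulr_ge0 // ltW.
  move=> x y Ex Ey; apply: le_trans (_ : d%:R * (2 * (C * r ^+ n) + 0) <= _); last first.
    have -> : (d%:R * (2 * C) + 1) * r ^+ n = d%:R * (2 * (C * r ^+ n) + 0) + r ^+ n by ring.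
    by rewrite lerDl.
  apply: (enorm_le_near (a := word_map f (nth [::] W i) z) (b := word_map f (nth [::] W i) z)).
  - by rewrite -enormN opprB.
  - by rewrite subrr enorm0.
  - by rewrite -enormN opprB.
have cover_ge La : 1 <= La -> La < L -> exists m B n0 : nat,
  [/\ (0 < m)%N, La ^+ m <= B%:R &
   forall (E : nat -> set 'rV[R]_d) (k : nat -> nat), F `<=` \bigcup_i E i ->
   (forall i, E i !=set0 -> (diam (E i) <= (r ^+ (n0 + m * k i))%:E)%E) ->
   exists I, 1 <= c * \sum_(i < I) (if E i == set0 then 0 else (B%:R : R) ^- k i)].
  move=> La1 LaL; have [m [B [v [m0 LaB reg]]]] := many_t La La1 LaL.
  exists m, B, (size v); split=> // E k; apply: cover_bound => //.
  rewrite -(ltr_nat R); apply: lt_le_trans LaB.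
  by rewrite exprn_gt0 // (lt_le_trans _ La1).
rewrite DE; split.
  apply: hausdorff_dim_eq; first by rewrite -DE.
  - exact: (hausdorff_measure0 hr L1 A0 cover few_t).
  - exact: (hausdorff_measure_neq0 hr L1 c0 cover_ge).
apply: has_box_dim_eq.
- exact: (covering_number_le hr L1 A0 cover few_t).
- exact: (covering_number_ge hr L1 c0 cover_ge).
Qed.
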